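(* Let $L>0$, $h^*>0$, $g>0$, $\mu>0$, $\sigma>0$ and $\bar\kappa\ge 0$ be constants, let $c=\sqrt{gh^*}$, and let $\bar S=\{\varphi\in H^2(0,L):\varphi'(0)=\varphi'(L)=0\}$. There exist constants $\bar M,\bar\lambda,\Gamma>0$ such that for every $f\in C^0(\mathbb{R}_+)$ and every function $$\varphi\in C^0(\mathbb{R}_+;\bar S\cap H^4(0,L))\cap C^1(\mathbb{R}_+;\bar S)\cap C^2(\mathbb{R}_+;L^2(0,L))$$ that satisfies for all $t\ge0$ $$\varphi_{tt}=c^2\varphi_{xx}-\sigma h^*\varphi_{xxxx}+\mu\varphi_{txx}-\bar\kappa\varphi_t \ \text{ on } (0,L),$$ $$\varphi_x(t,0)=\varphi_x(t,L)=0,\qquad \varphi_{xxx}(t,0)=\varphi_{xxx}(t,L)=-\sigma^{-1}f(t),$$ $$\int_0^L\varphi(t,x)\,dx=\int_0^L\varphi_t(t,x)\,dx=0,$$ the following estimate holds for all $t\ge 0$: $$P(t)\le \bar M\exp(-\bar\lambda t)P(0)+\Gamma\max_{0\le s\le t}\big(\exp(-\bar\lambda(t-s))|f(s)|\big),$$ where $P(t):=\big(\|\varphi[t]\|_2^2+\|\varphi_x[t]\|_2^2+\|\varphi_{xx}[t]\|_2^2+\|\varphi_t[t]\|_2^2\big)^{1/2}$.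
   Context: $\mathbb{R}_+=[0,+\infty)$. For a function $\varphi$ of $(t,x)$, $\varphi[t]$ denotes the profile $x\mapsto\varphi(t,x)$, and $\|\cdot\|_2$ is the $L^2(0,L)$ norm. For a normed space $Y$, $C^k(\mathbb{R}_+;Y)$ denotes $k$-times continuously differentiable maps $\mathbb{R}_+\to Y$; time derivatives (and mixed derivatives) are understood as derivatives of the maps $t\mapsto\varphi[t]$ (resp. $t\mapsto\varphi_{xx}[t]$) in the corresponding function spaces; $x$-derivatives are weak spatial derivatives. $H^k(0,L)$ is the usual Sobolev space. *)

(* Defs.v *)
From HB Require Import structures.
From mathcomp Require Import all_boot all_order all_algebra.
From mathcomp Require Import all_classical all_reals all_analysis.
Set Implicit Arguments. Unset Strict Implicit. Unset Printing Implicit Defensive.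
Import Order.TTheory GRing.Theory Num.Theory.
Import numFieldNormedType.Exports.
Local Open Scope classical_set_scope.
Local Open Scope ring_scope.

Section Sobolev.
Variable R : realType.
Local Notation mu := (@lebesgue_measure R).

Definition Iopen (L : R) : set R := [set x | 0 < x < L].

Definition L2fun (L : R) (u : R -> R) : Prop :=
  measurable_fun (Iopen L) u /\
  mu.-integrable (Iopen L) (fun x => ((u x) ^+ 2)%:E).

Definition norm2 (L : R) (u : R -> R) : R :=
  Num.sqrt (Rintegral mu (Iopen L) (fun x => (u x) ^+ 2)).

Definition test_fun (L : R) (psi : R -> R) : Prop :=
  (forall (n : nat) (x : R), derivable (derive1n n psi) x 1) /\
  exists a b : R, 0 < a /\ a < b /\ b < L /\
    (forall x, (x < a \/ b < x) -> psi x = 0).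

Definition weak_deriv (L : R) (u g : R -> R) : Prop :=
  forall psi, test_fun L psi ->
    Rintegral mu (Iopen L) (fun x => u x * derive1 psi x) =
    - Rintegral mu (Iopen L) (fun x => g x * psi x).

(* U j is the j-th weak derivative of U 0, and U 0, ..., U k are in L^2:
   i.e. U 0 is in H^k(0,L), with its weak derivatives listed in U. *)
Definition Hk_fam (L : R) (k : nat) (U : nat -> R -> R) : Prop :=
  (forall j, (j <= k)%N -> L2fun L (U j)) /\
  (forall j, (j < k)%N -> weak_deriv L (U j) (U j.+1)).

Definition Hk_dist (L : R) (k : nat) (U V : nat -> R -> R) : R :=
  \sum_(j < k.+1) norm2 L (fun x => U j x - V j x).

Definition trace_at (L : R) (u : R -> R) (a v : R) : Prop :=
  exists w : R -> R,
    {within `[0, L], continuous w} /\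
    (\forall x \ae mu, Iopen L x -> u x = w x) /\ w a = v.

Definition in_Sbar (L : R) (U : nat -> R -> R) : Prop :=
  Hk_fam L 2 U /\ trace_at L (U 1%N) 0 0 /\ trace_at L (U 1%N) L 0.

Definition cont_Hk (L : R) (k : nat) (U : R -> nat -> R -> R) : Prop :=
  forall t, 0 <= t -> forall eps, 0 < eps -> exists2 delta, 0 < delta &
    forall s, 0 <= s -> `|s - t| < delta -> Hk_dist L k (U s) (U t) < eps.

Definition deriv_Hk (L : R) (k : nat) (U V : R -> nat -> R -> R) : Prop :=
  forall t, 0 <= t -> forall eps, 0 < eps -> exists2 delta, 0 < delta &
    forall s, 0 <= s -> s != t -> `|s - t| < delta ->
      Hk_dist L k (fun j x => (U s j x - U t j x) / (s - t)) (V t) < eps.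

End Sobolev.

(* Main.v *)
Require Import Defs.
From HB Require Import structures.
From mathcomp Require Import all_boot all_order all_algebra.
From mathcomp Require Import all_classical all_reals all_analysis.
From mathcomp Require Import measurable_realfun ring lra.
Import Order.TTheory GRing.Theory Num.Theory.
Import numFieldNormedType.Exports.
Set Implicit Arguments. Unset Strict Implicit. Unset Printing Implicit Defensive.
Local Open Scope classical_set_scope.
Local Open Scope ring_scope.

(** With psi = phi_t and c^2 = g h^*, the modified energy
      V = |psi|^2/2 + c^2 |phi_x|^2/2 + sigma h^* |phi_xx|^2/2
          + e (<phi, psi> + mu |phi_x|^2/2 + kappa |phi|^2/2)
    satisfies
      V' = h^* f int psi_x - mu |psi_x|^2 - kappa |psi|^2
           + e (|psi|^2 - c^2 |phi_x|^2 + h^* f int phi_x - sigma h^* |phi_xx|^2),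
    the control f entering only through phi_xxx(0) = phi_xxx(L) = - f / sigma.
    The Poincare inequality for functions of zero mean makes V equivalent to P^2
    when e is small, and gives V' <= - nu V + gam f^2; the rate lam = nu / 4 leaves
    room to absorb the integral of f^2 into a weighted supremum.
    Every integration by parts pairs a weak derivative u' with a function v having
    equal traces at both ends; it reduces to Fubini's theorem once u and v are
    known to be primitives of their weak derivatives up to a constant, which is the
    du Bois-Reymond lemma. *)

(** * The space L^2(0, L) *)

Section L2.
Variables (R : realType) (L : R).
Local Notation mu := (@lebesgue_measure R).
Local Notation I := (@Iopen R L).
Implicit Types u v w : R -> R.

Definition ip u v : R := \int[mu]_(x in I) (u x * v x).

Lemma IopenE : I = `]0, L[%classic.
Proof. by apply/seteqP; split => x; rewrite /= in_itv. Qed.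

Lemma measurable_Iopen : measurable (I : set (measurableTypeR R)).
Proof. by rewrite IopenE; exact: measurable_itv. Qed.
Local Hint Resolve measurable_Iopen : core.

Lemma lebesgue_Iopen : 0 < L -> mu I = L%:E.
Proof. by move=> L0; rewrite IopenE lebesgue_measure_itv /= lte_fin L0 oppr0 adde0. Qed.

Lemma lebesgue_Iopen_fin : (mu I < +oo)%E.
Proof.
by rewrite IopenE lebesgue_measure_itv /=; case: ifP => _; rewrite ?ltry// -EFinD ltry.
Qed.

Lemma measurable_L2 u : L2fun L u -> measurable_fun (I : set (measurableTypeR R)) u.
Proof. by case. Qed.
Local Hint Resolve measurable_L2 : core.

(** The product is dominated by [u^2 + v^2]. *)
Lemma L2_mul_integrable u v : L2fun L u -> L2fun L v ->
  mu.-integrable I (EFin \o (fun x => u x * v x)).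
Proof.
move=> [mu_ iu] [mv iv].
have h := integrableD measurable_Iopen iu iv.
apply: (le_integrable measurable_Iopen _ _ h).
  by apply/measurable_EFinP; apply: measurable_funM.
move=> x _ /=; rewrite lee_fin [leRHS]ger0_norm.
  by rewrite ler_norml; apply/andP; split; nra.
by apply: addr_ge0; exact: sqr_ge0.
Qed.

Lemma L2_cst (a : R) : L2fun L (fun=> a).
Proof.
split; first exact: measurable_cst.
apply/integrableP; split; first by apply/measurable_EFinP; exact: measurable_cst.
by rewrite integral_cst//= lte_mul_pinfty// lebesgue_Iopen_fin.
Qed.
Local Hint Resolve L2_cst : core.

Lemma L2_bounded u (M : R) : measurable_fun (I : set (measurableTypeR R)) u ->
  (forall x, I x -> `|u x| <= M) -> L2fun L u.
Proof.
move=> mu_ bu; split=> //.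
apply: (le_integrable measurable_Iopen _ _ (L2_cst M).2).
  by apply/measurable_EFinP; apply: measurable_funX.
move=> x Ix /=; rewrite lee_fin !normrX lerXn2r ?nnegrE//.
by rewrite (le_trans (bu x Ix))// ler_norm.
Qed.

Lemma L2_integrable u : L2fun L u -> mu.-integrable I (EFin \o u).
Proof.
move=> Lu; have := L2_mul_integrable Lu (L2_cst 1).
by apply: eq_integrable => // x _ /=; rewrite mulr1.
Qed.

Lemma L2D u v : L2fun L u -> L2fun L v -> L2fun L (fun x => u x + v x).
Proof.
move=> Lu Lv; split; first by apply: measurable_funD; exact: measurable_L2.
have i2 := integrableD measurable_Iopen Lu.2 Lv.2.
(* The majorant of [(u + v)^2] is [2 (u^2 + v^2)], written as a sum of two equal integrable
   functions. *)
have := integrableD measurable_Iopen i2 i2.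
apply: (le_integrable measurable_Iopen).
  by apply/measurable_EFinP; apply: measurable_funX; apply: measurable_funD; exact: measurable_L2.
move=> x _ /=; rewrite lee_fin ger0_norm ?sqr_ge0//.
rewrite ger0_norm; first by have := sqr_ge0 (u x - v x); nra.
by do !apply: addr_ge0; exact: sqr_ge0.
Qed.

Lemma L2Z (a : R) u : L2fun L u -> L2fun L (fun x => a * u x).
Proof.
move=> Lu; split; first by apply: measurable_funM; exact: measurable_L2.
have := integrableZl measurable_Iopen (a ^+ 2) Lu.2.
by apply: eq_integrable => // x _ /=; rewrite -EFinM exprMn.
Qed.

Lemma L2B u v : L2fun L u -> L2fun L v -> L2fun L (fun x => u x - v x).
Proof.
move=> Lu Lv; have := L2D Lu (L2Z (-1) Lv).
by under eq_fun do rewrite mulN1r.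
Qed.

Lemma ipC u v : ip u v = ip v u.
Proof. by apply: eq_Rintegral => x _; rewrite mulrC. Qed.

Lemma ipDl u v w : L2fun L u -> L2fun L v -> L2fun L w ->
  ip (fun x => u x + v x) w = ip u w + ip v w.
Proof.
move=> Lu Lv Lw; rewrite /ip -RintegralD//; try exact: L2_mul_integrable.
by apply: eq_Rintegral => x _; rewrite mulrDl.
Qed.

Lemma ipZl (a : R) u w : L2fun L u -> L2fun L w ->
  ip (fun x => a * u x) w = a * ip u w.
Proof.
move=> Lu Lw; rewrite /ip -RintegralZl//; last exact: L2_mul_integrable.
by apply: eq_Rintegral => x _; rewrite mulrA.
Qed.

Lemma ipBl u v w : L2fun L u -> L2fun L v -> L2fun L w ->
  ip (fun x => u x - v x) w = ip u w - ip v w.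
Proof.
move=> Lu Lv Lw; rewrite /ip -RintegralB//; try exact: L2_mul_integrable.
by apply: eq_Rintegral => x _; rewrite mulrBl.
Qed.

Lemma ipDr u v w : L2fun L u -> L2fun L v -> L2fun L w ->
  ip w (fun x => u x + v x) = ip w u + ip w v.
Proof. by move=> *; rewrite ipC ipDl// ![ip w _]ipC. Qed.

Lemma ipBr u v w : L2fun L u -> L2fun L v -> L2fun L w ->
  ip w (fun x => u x - v x) = ip w u - ip w v.
Proof. by move=> *; rewrite ipC ipBl// ![ip w _]ipC. Qed.

Lemma ipZr (a : R) u w : L2fun L u -> L2fun L w ->
  ip w (fun x => a * u x) = a * ip w u.
Proof. by move=> *; rewrite ipC ipZl// ![ip w _]ipC. Qed.

Lemma ip_ge0 u : 0 <= ip u u.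
Proof. by apply: Rintegral_ge0 => x _; rewrite -expr2 sqr_ge0. Qed.

Lemma norm2_sq u : norm2 L u ^+ 2 = ip u u.
Proof. by rewrite /norm2 sqr_sqrtr//; exact: ip_ge0. Qed.

Lemma norm2_ge0 u : 0 <= norm2 L u.
Proof. exact: sqrtr_ge0. Qed.

Lemma ip1_cst : 0 < L -> ip (fun=> 1) (fun=> 1) = L.
Proof.
move=> L0; rewrite /ip; under eq_Rintegral do rewrite mulr1.
by rewrite Rintegral_cst// mul1r -[RHS]/(fine L%:E) -lebesgue_Iopen.
Qed.

Lemma ip_cstl (c : R) u : L2fun L u -> ip (fun=> c) u = c * ip u (fun=> 1).
Proof.
by move=> Lu; rewrite ipC -ipZr//; apply: eq_Rintegral => x _; rewrite mulr1.
Qed.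

Lemma ip1r u : ip u (fun=> 1) = \int[mu]_(x in I) u x.
Proof. by apply: eq_Rintegral => x _; rewrite mulr1. Qed.

(** The quadratic form [|a u - b v|^2] is nonnegative; the choice [a = ip u v], [b = ip u u] gives
    the claim up to the factor [ip u u]. *)
Lemma L2_CauchySchwarz_sq u v : L2fun L u -> L2fun L v ->
  ip u v ^+ 2 <= ip u u * ip v v.
Proof.
move=> Lu Lv; have key a b : 0 <= a ^+ 2 * ip u u - 2 * a * b * ip u v + b ^+ 2 * ip v v.
  have := ip_ge0 (fun x => a * u x - b * v x).
  have La := L2Z a Lu; have Lb := L2Z b Lv; have Lab := L2B La Lb.
  rewrite ipBl// !ipBr// !ipZl// !ipZr// (ipC v u); nra.
have [u0|u0] := ltP 0 (ip u u).
  rewrite -(ler_pM2l u0) -subr_ge0; apply: le_trans (key (ip u v) (ip u u)) _.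
  by rewrite le_eqVlt; apply/orP; left; apply/eqP; ring.
have {}u0 : ip u u = 0 by apply/eqP; rewrite eq_le u0 ip_ge0.
rewrite u0 mul0r; have [->|n0] := eqVneq (ip u v) 0; first by rewrite expr0n.
(* With [ip u u = 0] the form is affine in [a]. This value of [a] makes it equal to [- ip v v - 2],
   which is negative. *)
have := key ((ip v v + 1) / ip u v) 1; rewrite u0 => h.
have e : 2 * ((ip v v + 1) / ip u v) * 1 * ip u v = 2 * (ip v v + 1) by field.
by exfalso; move: h; rewrite e; have := ip_ge0 v; lra.
Qed.

Lemma L2_CauchySchwarz u v : L2fun L u -> L2fun L v ->
  `|ip u v| <= norm2 L u * norm2 L v.
Proof.
move=> Lu Lv.
rewrite -[leRHS]ger0_norm; last by rewrite mulr_ge0// norm2_ge0.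
rewrite -ler_sqr ?nnegrE// !real_normK ?num_real// exprMn !norm2_sq.
exact: L2_CauchySchwarz_sq.
Qed.

Lemma ae_eq_ip u v w : L2fun L u -> L2fun L v -> L2fun L w ->
  (\forall x \ae mu, I x -> u x = v x) -> ip u w = ip v w.
Proof.
move=> Lu Lv Lw uv; rewrite /ip /Rintegral; congr fine.
apply: ae_eq_integral => //.
- by apply/measurable_EFinP; apply: measurable_funM; exact: measurable_L2.
- by apply/measurable_EFinP; apply: measurable_funM; exact: measurable_L2.
- apply: filterS uv; first exact: (ae_filter_ringOfSetsType mu).
  by move=> x h /h /= ->.
Qed.

Lemma ip_eq0_ae u : L2fun L u -> ip u u = 0 ->
  \forall x \ae mu, I x -> u x = 0.
Proof.
move=> Lu u0.
have iu := L2_mul_integrable Lu Lu.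
have : (\int[mu]_(x in I) `|(u x * u x)%:E| = 0)%E.
  rewrite -[RHS](_ : (ip u u)%:E = 0%E); last by rewrite u0.
  rewrite /ip /Rintegral fineK; last exact: integrable_fin_num iu.
  apply: eq_integral => x _; rewrite abse_EFin ger0_norm//.
  by rewrite -expr2 sqr_ge0.
move/(ae_eq_integral_abs _ measurable_Iopen _).1 => h.
have {}h := h (measurable_int _ iu).
apply: filterS h => x h /h [] /eqP.
by rewrite mulf_eq0 orbb => /eqP.
Qed.

End L2.
#[global] Hint Resolve measurable_Iopen L2_cst : core.

(** * Smooth bump functions *)

Section Bump.
Variable R : realType.
Implicit Types (f g : R -> R) (x y : R).

(* The factor y^-k makes the family stable under differentiation:
   (flat k)' = flat (k + 2) - k flat (k + 1). *)
Definition flat (k : nat) y : R := if 0 < y then y^-1 ^+ k * expR (- y^-1) else 0.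

Lemma flat_ge0 k y : 0 <= flat k y.
Proof.
rewrite /flat; case: ifP => // y0.
by rewrite mulr_ge0 ?expR_ge0// exprn_ge0// invr_ge0 ltW.
Qed.

Lemma flat_le_sq k y : flat k y <= (k.+2)`!%:R * y ^+ 2.
Proof.
rewrite /flat; case: ifP => y0; last by rewrite mulr_ge0 ?sqr_ge0.
have z0 : 0 < y^-1 by rewrite invr_gt0.
have h := expR_ge1Dxn k.+1 (ltW z0).
have F0 : 0 < (k.+2)`!%:R :> R by rewrite ltr0n fact_gt0.
have {}h : y^-1 ^+ k.+2 <= (k.+2)`!%:R * expR y^-1.
  by rewrite -ler_pdivrMl// mulrC; lra.
rewrite expRN ler_pdivrMr ?expR_gt0// mulrAC.
have -> : y^-1 ^+ k = y^-1 ^+ k.+2 * y ^+ 2.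
  by rewrite -addn2 exprD -mulrA -exprMn mulVf ?gt_eqF// expr1n mulr1.
by rewrite ler_wpM2r// sqr_ge0.
Qed.

Lemma flat0_le1 y : flat 0 y <= 1.
Proof.
rewrite /flat; case: ifP => // y0.
by rewrite expr0 mul1r expR_le1 oppr_le0 invr_ge0 ltW.
Qed.

Lemma is_derive_near f g x (d : R) : (\forall y \near x, f y = g y) ->
  is_derive x 1 g d -> is_derive x 1 f d.
Proof. by move=> fg; apply: near_eq_is_derive; apply: filterS fg => y ->. Qed.

Lemma is_derive_eps f x (d : R) :
  (forall eps : R, 0 < eps -> exists2 delta : R, 0 < delta &
    forall h : R, h != 0 -> `|h| < delta -> `|(f (x + h) - f x) / h - d| < eps) ->
  is_derive x 1 f d.
Proof.
move=> H.
have cv : h^-1 *: ((f \o shift x) (h *: 1) - f x) @[h --> 0^'] --> d.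
  apply/cvgrPdist_lt => e e0; have [dl dl0 Hd] := H _ e0.
  exists dl => //= h; rewrite /= sub0r normrN => hd h0.
  rewrite distrC /GRing.scale/= mulr1 (addrC h) mulrC.
  exact: Hd.
apply: DeriveDef; first by apply/cvg_ex; exists d.
exact/cvg_lim.
Qed.

Lemma is_derive_flat k x :
  is_derive x 1 (flat k) (flat k.+2 x - k%:R * flat k.+1 x).
Proof.
have [x0|x0|->] := ltgtP x 0.
- have -> : flat k.+2 x - k%:R * flat k.+1 x = 0.
    by rewrite /flat !(ltNge 0 x) (ltW x0)/= mulr0 subr0.
  apply: (@is_derive_near _ (cst 0)).
  near=> y; rewrite /flat ifF//; apply/negbTE; rewrite -leNgt.
  by near: y; apply: filterS (lt_nbhsl x0) => y /ltW.
- apply: (@is_derive_near _ ((fun y => y^-1) ^+ k * (expR \o (fun y => - y^-1)))).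
    near=> y; rewrite /flat ifT//; first by rewrite fctE/= exprfctE.
    by near: y; exact: lt_nbhsr.
  have hV : is_derive x 1 (fun y : R => y^-1) (- x ^- 2).
    have := @is_deriveV R (fun y => y) x 1 1 (lt0r_neq0 x0) (is_derive_id _ _).
    by rewrite /GRing.scale/= mulr1.
  have hN : is_derive x 1 (fun y : R => - y^-1) (x ^- 2).
    by have := is_deriveN hV; rewrite opprK.
  have hE := @is_derive1_comp _ expR (fun y => - y^-1) x _ _ (is_derive_expR (- x^-1)) hN.
  have hP := is_deriveX k hV.
  apply: (is_derive_eq (is_deriveM hP hE)).
  rewrite /flat x0 exprfctE /GRing.scale/= -!exprVn.
  by case: (k) => [|j]; rewrite /= ?mul0r ?expr0 ?exprS; ring.
- have -> : flat k.+2 0 - k%:R * flat k.+1 0 = 0 by rewrite /flat !ltxx mulr0 subr0.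
  apply: is_derive_eps => e e0; set C : R := (k.+2)`!%:R.
  have C0 : 0 < C by rewrite ltr0n fact_gt0.
  exists (e / C) => [|h h0 hd]; first by rewrite divr_gt0.
  rewrite subr0 add0r {2}/flat ltxx subr0 normrM normfV ger0_norm ?flat_ge0//.
  have h1 : 0 < `|h| by rewrite normr_gt0.
  rewrite ltr_pdivrMr//; apply: le_lt_trans (flat_le_sq k h) _.
  rewrite -/C -real_normK ?num_real// expr2 mulrA ltr_pM2r// mulrC.
  by rewrite -ltr_pdivlMr.
Unshelve. all: by end_near.
Qed.

(** A syntactic algebra closed under differentiation: one induction then gives derivatives of all
    orders, and the bumps used below, with their linear combinations, belong to it. *)
Inductive flat_alg : (R -> R) -> Prop :=
| flat_base k m c : flat_alg (fun x => flat k (m * x + c))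
| flat_cst c : flat_alg (fun=> c)
| flat_add f g : flat_alg f -> flat_alg g -> flat_alg (fun x => f x + g x)
| flat_mul f g : flat_alg f -> flat_alg g -> flat_alg (fun x => f x * g x).

Lemma flat_alg_derive f : flat_alg f ->
  exists2 g, flat_alg g & forall x, is_derive x 1 f (g x).
Proof.
elim=> [k m c|c|{}f g _ [f' Af' df'] _ [g' Ag' dg']|
        {}f g Af [f' Af' df'] Ag [g' Ag' dg']].
- exists (fun x => m * (flat k.+2 (m * x + c) + (- k%:R) * flat k.+1 (m * x + c))).
    apply: (@flat_mul (fun=> m)); first exact: flat_cst.
    apply: flat_add; first exact: flat_base.
    by apply: (@flat_mul (fun=> - k%:R)); [exact: flat_cst|exact: flat_base].
  move=> x; have h : is_derive x 1 (fun x => m * x + c) m.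
    apply: is_derive_eq; by rewrite /GRing.scale/= mulr1 addr0.
  have := @is_derive1_comp _ (flat k) (fun x => m * x + c) x _ _ (is_derive_flat k (m * x + c)) h.
  by move=> h2; apply: (is_derive_eq h2); ring.
- by exists (fun=> 0); [exact: flat_cst|move=> x; exact: is_derive_cst].
- by exists (fun x => f' x + g' x); [exact: flat_add|move=> x; exact: is_deriveD].
- exists (fun x => f x * g' x + g x * f' x).
    by apply: flat_add; exact: flat_mul.
  by move=> x; have := is_deriveM (df' x) (dg' x).
Qed.

Lemma flat_alg_smooth f : flat_alg f ->
  forall (n : nat) x, derivable (derive1n n f) x 1.
Proof.
move=> + n; elim: n f => [|n IH] f /flat_alg_derive[g Ag df] x.
  by have [] := df x.
rewrite derive1Sn (_ : derive1 f = g); first exact: IH.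
by apply/funext => y; rewrite derive1E; have [] := df y.
Qed.

Lemma flat_alg_continuous f : flat_alg f -> continuous f.
Proof.
move=> /flat_alg_derive[g _ df] x; apply: differentiable_continuous.
by apply/derivable1_diffP; have [] := df x.
Qed.

(** For [m > 0] this is a smooth function positive exactly on (a, b). The parameter [m] is a
    steepness: as it grows, the bump tends to the indicator of (a, b). *)
Definition flat_bump (m a b x : R) : R := flat 0 (m * (x - a)) * flat 0 (m * (b - x)).

Lemma flat_alg_flat_bump m a b : flat_alg (flat_bump m a b).
Proof.
rewrite (_ : flat_bump m a b = fun x => flat 0 (m * x + - (m * a)) * flat 0 (- m * x + m * b)).
  by apply: flat_mul; exact: flat_base.
apply/funext => x; rewrite /flat_bump; congr (flat 0 _ * flat 0 _); ring.
Qed.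

Lemma flat_bump_ge0 m a b x : 0 <= flat_bump m a b x.
Proof. by rewrite mulr_ge0 ?flat_ge0. Qed.

Lemma flat_bump_le1 m a b x : flat_bump m a b x <= 1.
Proof. by rewrite mulr_ile1 ?flat_ge0 ?flat0_le1. Qed.

Lemma flat_bump_out m a b x : 0 < m -> x <= a \/ b <= x -> flat_bump m a b x = 0.
Proof.
move=> m0 [h|h]; rewrite /flat_bump.
  by rewrite [X in X * _](_ : _ = 0) ?mul0r// /flat pmulr_rgt0// subr_gt0 ltNge h.
by rewrite [X in _ * X](_ : _ = 0) ?mulr0// /flat pmulr_rgt0// subr_gt0 ltNge h.
Qed.

Lemma flat_bump_gt0 m a b x : 0 < m -> a < x < b -> 0 < flat_bump m a b x.
Proof.
move=> m0 /andP[ax xb]; have key z : 0 < z -> 0 < flat 0 (m * z).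
  by move=> z0; rewrite /flat pmulr_rgt0// z0 expr0 mul1r expR_gt0.
by rewrite mulr_gt0// key// subr_gt0.
Qed.

Lemma flat_bump_cvg a b x : a < x < b -> (fun n => flat_bump n.+1%:R a b x) @ \oo --> (1 : R).
Proof.
move=> /andP[ax xb].
have key (z : R) : 0 < z -> (fun n => flat 0 (n.+1%:R * z)) @ \oo --> (1 : R).
  move=> z0; rewrite (_ : (fun n => _) = (fun n => expR (- (n.+1%:R^-1 * z^-1)))); last first.
    by apply/funext => n; rewrite /flat pmulr_rgt0// z0 expr0 mul1r invfM.
  rewrite -[X in _ --> X]expR0; apply: continuous_cvg; first exact: continuous_expR.
  rewrite -oppr0; apply: cvgN; rewrite -(mul0r z^-1); apply: cvgMl.
  exact: cvg_harmonic.
rewrite -[X in _ --> X](mulr1 1); apply: cvgM; apply: key; by rewrite subr_gt0.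
Qed.

End Bump.

(** * Primitives and weak derivatives *)

Section Primitive.
Variables (R : realType) (L : R).
Local Notation mu := (@lebesgue_measure R).
Local Notation I := (@Iopen R L).
Local Notation T := (measurableTypeR R).
Implicit Types u v h k : R -> R.

Lemma ae_neq (a : R) : \forall x \ae mu, x != a.
Proof.
exists [set a]; split; first exact: measurable_set1.
  exact: lebesgue_measure_set1.
by move=> x /= /negP; rewrite negbK => /eqP.
Qed.

Lemma L2_norm u : L2fun L u -> L2fun L (fun x => `|u x|).
Proof.
move=> Lu; split.
  by apply: (measurableT_comp (@normr_measurable R setT)); exact: measurable_L2.
by apply: eq_integrable Lu.2 => // x _ /=; rewrite real_normK ?num_real.
Qed.

Lemma measurable_lt_l (x : R) : measurable_fun setT (fun y : T => (y < x)%R%:R : R).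
Proof.
rewrite (_ : (fun y => _) = (fun y : T => if y < x then 1 else 0 : R)); last first.
  by apply/funext => y; case: ifP.
apply: measurable_fun_ifT => //; apply: measurable_fun_ltr => //.
Qed.

Lemma measurable_lt_r (x : R) : measurable_fun setT (fun y : T => (x < y)%R%:R : R).
Proof.
rewrite (_ : (fun y => _) = (fun y : T => if x < y then 1 else 0 : R)); last first.
  by apply/funext => y; case: ifP.
apply: measurable_fun_ifT => //; apply: measurable_fun_ltr => //.
Qed.

Lemma L2_lt_l (x : R) : L2fun L (fun y => (y < x)%R%:R).
Proof.
apply: (@L2_bounded _ _ _ 1).
  by apply: measurable_funS (measurable_lt_l x).
by move=> y _; case: (y < x); rewrite ?normr1 ?normr0.
Qed.

Lemma L2_lt_r (x : R) : L2fun L (fun y => (x < y)%R%:R).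
Proof.
apply: (@L2_bounded _ _ _ 1).
  by apply: measurable_funS (measurable_lt_r x).
by move=> y _; case: (x < y); rewrite ?normr1 ?normr0.
Qed.
Hint Resolve L2_lt_l L2_lt_r : core.

Lemma ip_integralT h k : L2fun L h -> L2fun L k ->
  (\int[mu]_y ((h \_ I) y * k y)%:E = (ip L h k)%:E)%E.
Proof.
move=> Lh Lk; have ihk := L2_mul_integrable Lh Lk.
rewrite /ip /Rintegral fineK; last exact: integrable_fin_num ihk.
rewrite [RHS]integral_mkcond; apply: eq_integral => x _ /=.
by rewrite /patch; case: ifP => //; rewrite mul0r.
Qed.

(** The primitive of [h] vanishing at 0, extended by constants outside (0, L). Writing it as an
    inner product with an indicator makes Cauchy-Schwarz and Fubini directly applicable. *)
Definition prim h (x : R) : R := ip L h (fun y => (y < x)%R%:R).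

Lemma ip_lt_r h (x : R) : L2fun L h ->
  ip L h (fun y => (x < y)%R%:R) = ip L h (fun=> 1) - prim h x.
Proof.
move=> Lh; rewrite /prim -ipBr//; apply: (etrans (ipC _ _ _)).
rewrite [RHS]ipC; apply: ae_eq_ip => //; first exact: L2B.
apply: filterS (ae_neq x); first exact: (ae_filter_ringOfSetsType mu).
by move=> y yx _; rewrite ltNge le_eqVlt (negbTE yx)/=; case: (y < x); rewrite ?subrr ?subr0.
Qed.

Lemma prim_bound h x : L2fun L h -> `|prim h x| <= norm2 L h * norm2 L (fun=> 1).
Proof.
move=> Lh; have /le_trans := L2_CauchySchwarz Lh (L2_lt_l x); apply.
apply: ler_wpM2l; first exact: norm2_ge0.
rewrite -ler_sqr ?nnegrE ?norm2_ge0// !norm2_sq.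
apply: le_Rintegral => //; try exact: L2_mul_integrable.
by move=> y _; case: (y < x); rewrite ?mulr0 ?mulr1.
Qed.

(** Cauchy-Schwarz against the indicator of [[x, z[], whose squared norm on (0, L) is at most
    [z - x]. Primitives are thus Hoelder continuous with exponent 1/2. *)
Lemma prim_sub h (x z : R) : L2fun L h -> x <= z ->
  (prim h z - prim h x) ^+ 2 <= ip L h h * (z - x).
Proof.
move=> Lh xz; rewrite /prim -ipBr//.
have Lq := L2B (L2_lt_l z) (L2_lt_l x).
apply: le_trans (L2_CauchySchwarz_sq Lh Lq) _.
apply: ler_wpM2l; first exact: ip_ge0.
set q := (fun y : R => _) in Lq *.
have -> : z - x = fine (mu (`[x, z[%classic)).
  rewrite lebesgue_measure_itv/= lte_fin; case: ltP => //= zx.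
  by apply/eqP; rewrite subr_eq0 eq_le xz zx.
rewrite /ip /Rintegral fine_le//.
- exact: integrable_fin_num (L2_mul_integrable Lq Lq).
- by rewrite lebesgue_measure_itv/= lte_fin; case: ifP.
have <- : (\int[mu]_y (\1_(`[x, z[%classic) y)%:E = mu (`[x, z[%classic : set T))%E.
  by rewrite integral_indic ?setIT//; exact: measurable_itv.
rewrite integral_mkcond; apply: ge0_le_integral => //.
- by move=> y _; rewrite /patch; case: ifP => // _; rewrite lee_fin -expr2 sqr_ge0.
- apply/(measurable_restrictT _ _).1 => //.
  by apply/measurable_EFinP; apply: measurable_funM; exact: measurable_L2.
- by apply/measurable_EFinP; apply: measurable_indic; exact: measurable_itv.
move=> y _; rewrite /patch /q indicE.
have -> : (y \in `[x, z[%classic) = (x <= y < z).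
  by apply/idP/idP => [/set_mem|hy]; [|apply/mem_set]; rewrite /= in_itv.
have [yx|xy] := ltP y x.
  by rewrite (lt_le_trans yx xz) subrr mulr0; case: ifP.
by case: (y < z); case: ifP; rewrite ?subr0 ?mulr1 ?mulr0 ?lee_fin.
Qed.

Lemma prim_continuous h : L2fun L h -> continuous (prim h).
Proof.
move=> Lh x; apply/cvgrPdist_lt => e e0.
have N0 := ip_ge0 L h.
have d0 : 0 < e ^+ 2 / (ip L h h + 1).
  by rewrite divr_gt0// ?exprn_gt0//; lra.
have key a b : a <= b -> b - a < e ^+ 2 / (ip L h h + 1) -> `|prim h b - prim h a| < e.
  move=> ab; rewrite ltr_pdivlMr; last by lra.
  move=> hb; rewrite -ltr_sqr ?nnegrE// ?ltW// real_normK ?num_real//.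
  by apply: le_lt_trans (prim_sub Lh ab) _; nra.
exists (e ^+ 2 / (ip L h h + 1)) => //= y; rewrite /= => hy.
have [xy|yx] := leP x y.
  by rewrite distrC key// -(ger0_norm (x := y - x)) ?subr_ge0// distrC.
by rewrite key// ?ltW// -(ger0_norm (x := x - y)) ?subr_ge0// ltW.
Qed.

Lemma L2_prim h : L2fun L h -> L2fun L (prim h).
Proof.
move=> Lh; apply: (@L2_bounded _ _ _ (norm2 L h * norm2 L (fun=> 1))).
  apply: measurable_funS (continuous_measurable_fun (prim_continuous Lh)) => //.
by move=> x _; exact: prim_bound.
Qed.

Lemma prim_le0 h x : x <= 0 -> prim h x = 0.
Proof.
move=> x0; rewrite /prim /ip; under eq_Rintegral.
  move=> y /set_mem /andP[y0 _]; rewrite ltNge (le_trans x0 (ltW y0))/= mulr0.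
  over.
by rewrite Rintegral_cst// mul0r.
Qed.

Lemma prim_ge h x : L <= x -> prim h x = ip L h (fun=> 1).
Proof.
move=> Lx; apply: eq_Rintegral => y /set_mem /andP[_ yL].
by rewrite (lt_le_trans yL Lx).
Qed.

(** The two terms are the integrals of [h(y) k(x)] over the triangles [y < x] and [x < y], which
    fill the square up to a null set. This is integration by parts for primitives. *)
Lemma Fubini_prim h k : L2fun L h -> L2fun L k ->
  ip L (prim h) k + ip L h (prim k) = ip L h (fun=> 1) * ip L k (fun=> 1).
Proof.
move=> Lh Lk.
have Lph := L2_prim Lh; have Lpk := L2_prim Lk.
pose h0 := h \_ I; pose k0 := k \_ I.
pose F (p : T * T) : R := h0 p.2 * k0 p.1 * (p.2 < p.1)%R%:R.
have mh0 : measurable_fun setT (h0 : T -> R).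
  by apply/(measurable_restrictT _ _).1 => //; exact: measurable_L2.
have mk0 : measurable_fun setT (k0 : T -> R).
  by apply/(measurable_restrictT _ _).1 => //; exact: measurable_L2.
have mh2 : measurable_fun setT (fun p : T * T => h0 p.2).
  exact: (measurableT_comp mh0 measurable_snd).
have mk1 : measurable_fun setT (fun p : T * T => k0 p.1).
  exact: (measurableT_comp mk0 measurable_fst).
have mF : measurable_fun setT (EFin \o F).
  apply/measurable_EFinP; rewrite (_ : F = fun p => if p.2 < p.1 then h0 p.2 * k0 p.1 else 0).
    apply: measurable_fun_ifT => //; last exact: measurable_funM.
    by apply: measurable_fun_ltr; [exact: measurable_snd|exact: measurable_fst].
  by apply/funext => p; rewrite /F; case: ifP; rewrite ?mulr1 ?mulr0.
(* Fubini requires [F] to be integrable on the plane. The majorant [G] has separated variables, so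
   its integral is a product of two finite ones. *)
pose G (p : T * T) : R := `|h0 p.2| * `|k0 p.1|.
have mG : measurable_fun setT (EFin \o G).
  by apply/measurable_EFinP; apply: measurable_funM; apply: measurableT_comp.
have nI u : (fun x => `|u x|) \_ I = (fun x => `|(u \_ I) x|).
  by apply/funext => x; rewrite /patch; case: ifP => //; rewrite normr0.
have iG : (mu \x mu)%E.-integrable setT (EFin \o G).
  apply/integrable12ltyP => //.
  have inner x : (\int[mu]_y `|(EFin \o G) (x, y)| =
      (`|k0 x| * ip L (fun y => `|h y|%R) (fun=> 1))%:E)%E.
    rewrite -ipZr//; last exact: L2_norm.
    rewrite -ip_integralT//; last exact: L2_norm.
    apply: eq_integral => y _; rewrite nI /G/= ger0_norm ?mulr_ge0//.
    by rewrite mulr1.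
  under eq_integral do rewrite inner.
  rewrite (_ : (fun x => _) = (fun x => (((fun x => `|k x|) \_ I) x *
      ip L (fun y => `|h y|) (fun=> 1))%:E)); last first.
    by apply/funext => x; rewrite nI.
  by rewrite ip_integralT ?ltry//; exact: L2_norm.
have iF : (mu \x mu)%E.-integrable setT (EFin \o F).
  apply: le_integrable iG => //= p _.
  rewrite lee_fin /F /G !normrM normr_id normr_id.
  by case: (_ < _); rewrite ?normr1 ?normr0 ?mulr1 ?mulr0// mulr_ge0.
have := Fubini iF.
have -> : (\int[mu]_x \int[mu]_y (EFin \o F) (x, y) = (ip L k (prim h))%:E)%E.
  rewrite -ip_integralT//; apply: eq_integral => x _.
  rewrite -/(k0 x) -ipZr// -ip_integralT//; last exact: L2Z.
  by apply: eq_integral => y _; rewrite /F /= mulrA.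
(* In this order the inner integral of [k] runs over [x > y], hence equals its total integral minus
   its primitive. *)
have -> : (\int[mu]_y \int[mu]_x (EFin \o F) (x, y) =
    (ip L h (fun y => ip L k (fun=> 1) - prim k y))%:E)%E.
  rewrite -ip_integralT//; last exact: L2B.
  apply: eq_integral => y _; rewrite -ip_lt_r// -/(h0 y) -ipZr// -ip_integralT//; last exact: L2Z.
  by apply: eq_integral => x _; rewrite /F /= mulrA (mulrC (h0 y)).
rewrite ipBr// => -[]; rewrite (ipC L k) => ->; rewrite subrK.
have := @ipZr _ L (ip L k (fun=> 1)) (fun=> 1) h (L2_cst L 1) Lh.
by under [X in ip _ _ X]eq_fun do rewrite mulr1; move=> ->; rewrite mulrC.
Qed.

End Primitive.
#[global] Hint Resolve L2_lt_l L2_lt_r : core.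

(** * Weak derivatives: du Bois-Reymond lemma, traces, integration by parts, Poincare inequality *)

Section WeakDerivative.
Variables (R : realType) (L : R).
Local Notation mu := (@lebesgue_measure R).
Local Notation I := (@Iopen R L).
Local Notation T := (measurableTypeR R).
Implicit Types u v w h k g z : R -> R.

Lemma ae_itv_ex (P : R -> Prop) (a b : R) :
  (\forall x \ae mu, P x) -> a < b -> exists2 x, a < x < b & P x.
Proof.
move=> [N [mN N0 PN]] ab; apply: contrapT => nex.
have sub : (`]a, b[%classic : set T) `<=` N.
  move=> x /=; rewrite in_itv/= => xab; apply: PN => /= Px.
  by apply: nex; exists x.
have : (mu (`]a, b[%classic : set T) <= mu N)%E.
  by apply: le_measure; rewrite ?inE//; exact: measurable_itv.
by rewrite N0 lebesgue_measure_itv/= lte_fin ab -EFinD lee_fin leNgt subr_gt0 ab.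
Qed.

Lemma continuous_L2 u : continuous u -> L2fun L u.
Proof.
move=> cu; split.
  by apply: measurable_funS (continuous_measurable_fun cu).
have : mu.-integrable (`[0, L]%classic : set T) (EFin \o (fun x => u x ^+ 2)).
  apply: continuous_compact_integrable; first exact: segment_compact.
  apply: continuous_subspaceT => x.
  exact: (cvgM (cu x) (cu x)).
apply: integrableS; rewrite //.
by move=> x /= /andP[x0 xL]; rewrite in_itv/= !ltW.
Qed.

Lemma patch_integrable z : L2fun L z -> mu.-integrable setT (EFin \o (z \_ I)).
Proof.
move=> Lz; rewrite -restrict_EFin.
by apply/(integrable_mkcond _ (measurable_Iopen L)).1/L2_integrable.
Qed.

(** This rewrites [prim] in the form to which the fundamental theorem of calculus applies. *)
Lemma prim_itv z x : L2fun L z ->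
  prim L z x = \int[mu]_(t in `]-oo, x]) (z \_ I) t.
Proof.
move=> Lz; rewrite -Rintegral_itv_bndo_bndc; last first.
  by apply: integrableS (patch_integrable Lz) => //; exact: measurable_itv.
rewrite /prim /ip Rintegral_mkcond [RHS]Rintegral_mkcond.
apply: eq_Rintegral => t _; rewrite /patch.
have -> : (t \in `]-oo, x[%classic) = (t < x).
  by apply/idP/idP => [/set_mem|ht]; [|apply/mem_set]; rewrite /= in_itv.
by case: (t < x); case: ifP; rewrite ?mulr1 ?mulr0.
Qed.

Lemma prim_derive_ae z : L2fun L z ->
  \forall x \ae mu, derivable (prim L z) x 1 /\ derive1 (prim L z) x = (z \_ I) x.
Proof.
move=> Lz.
have H := @FTC1Ny R (z \_ I) _ (integrable_locally (measurable_Iopen L) (L2_integrable Lz)).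
have -> : prim L z = fun x => \int[mu]_(t in `]-oo, x]) (z \_ I) t.
  by apply/funext => x; exact: prim_itv.
apply: H => y.
by apply: integrableS (patch_integrable Lz) => //; exact: measurable_itv.
Qed.

Lemma prim_derive k (x : R) : continuous k -> (forall y, ~ I y -> k y = 0) ->
  is_derive x 1 (prim L k) (k x).
Proof.
move=> ck k0; have Lk := continuous_L2 ck.
have kI : k \_ I = k.
  by apply/funext => y; rewrite /patch; case: ifPn => // /negP; rewrite inE => /k0 ->.
have -> : prim L k = fun x => \int[mu]_(t in `]-oo, x]) k t.
  by apply/funext => y; rewrite prim_itv// kI.
have [| | | |dk ek] := @continuous_FTC1 R k (BInfty R true) x (x + 1).
- by rewrite ltrDl.
- by rewrite -kI; apply: integrableS (patch_integrable Lk) => //; exact: measurable_itv.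
- by rewrite ltNyr.
- exact: ck.
- by apply: (DeriveDef dk); rewrite -derive1E.
Qed.

(** The primitive vanishes left of [a] by the support of [k], and right of [b] because the total
    integral of [k] is zero. Its derivative is [k], so smoothness is inherited. *)
Lemma prim_test_fun k (a b : R) : flat_alg k -> 0 < a -> a < b -> b < L ->
  (forall x, x <= a \/ b <= x -> k x = 0) -> ip L k (fun=> 1) = 0 ->
  test_fun L (prim L k) /\ derive1 (prim L k) = k.
Proof.
move=> Ak a0 ab bL k0 ik.
have ck := flat_alg_continuous Ak; have Lk := continuous_L2 ck.
have kout y : ~ I y -> k y = 0.
  move=> nIy; apply: k0; have [|ay] := leP y a; first by left.
  have [|yb] := leP b y; first by right.
  by case: nIy; rewrite /Iopen/= (lt_trans a0 ay) (lt_trans yb bL).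
have dk : derive1 (prim L k) = k.
  by apply/funext => x; rewrite derive1E; have [] := prim_derive x ck kout.
split => //; split.
  move=> [|n] x; first by have [] := prim_derive x ck kout.
  by rewrite derive1Sn dk; exact: flat_alg_smooth.
exists a, b; split=> //; split=> //; split=> // x [xa|bx].
  rewrite /prim /ip -[RHS](mul0r (fine (mu I))) -Rintegral_cst//.
  apply: eq_Rintegral => y _; have [yx|] := ltP y x; last by rewrite mulr0.
  by rewrite k0 ?mul0r//; left; rewrite ltW// (lt_trans yx).
rewrite -ik; apply: eq_Rintegral => y _; have [|xy] := ltP y x => //.
by rewrite k0 ?mul0r//; right; rewrite ltW// (lt_le_trans bx).
Qed.

Lemma L2_itv (a b : R) : L2fun L (fun y => (a < y < b)%R%:R).
Proof.
have mq : measurable_fun setT (fun y : T => (a < y < b)%R%:R : R).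
  rewrite (_ : (fun y => _) = fun y : T => if (a < y) && (y < b) then 1 else 0); last first.
    by apply/funext => y; case: ifP.
  by apply: measurable_fun_ifT => //; apply: measurable_and;
    apply: measurable_fun_ltr.
apply: (@L2_bounded _ _ _ 1); first exact: measurable_funS mq.
by move=> y _; case: (a < y < b); rewrite ?normr1 ?normr0.
Qed.

(** Dominated convergence with majorant [|z|]: the bumps take values in [0, 1] and tend pointwise to
    the indicator. *)
Lemma ip_bump_cvg z (a b : R) : L2fun L z ->
  (forall n, ip L z (flat_bump n.+1%:R a b) = 0) ->
  ip L z (fun y => (a < y < b)%R%:R) = 0.
Proof.
move=> Lz zn0.
have Lb n : L2fun L (flat_bump n.+1%:R a b).
  exact/continuous_L2/flat_alg_continuous/flat_alg_flat_bump.
pose q := (fun y : R => (a < y < b)%R%:R : R).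
have Lq : L2fun L q by exact: L2_itv.
have iz := L2_mul_integrable Lz Lq.
have [] := @dominated_convergence _ _ _ mu I (measurable_Iopen L)
  (fun n x => (z x * flat_bump n.+1%:R a b x)%:E) (fun x => (z x * q x)%:E)
  (fun x => `|z x|%:E).
- by move=> n; exact: measurable_int (L2_mul_integrable Lz (Lb n)).
- exact: measurable_int iz.
- apply: aeW => x Ix; apply: cvg_EFin; first exact: nearW.
  apply: cvgMr; rewrite /q; have [xab|xab] := boolP (a < x < b).
    exact: flat_bump_cvg.
  rewrite (_ : (fun n => _) = cst 0); first exact: cvg_cst.
  apply/funext => n; apply: flat_bump_out => //.
  by move: xab; rewrite negb_and -!leNgt => /orP.
- exact/L2_integrable/L2_norm.
- apply: aeW => x n Ix; rewrite abse_EFin lee_fin normrM ler_piMr//.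
  by rewrite ger0_norm ?flat_bump_ge0// flat_bump_le1.
move=> _ _ cv.
have : (0 : \bar R)%E = (\int[mu]_(x in I) (z x * q x)%:E)%E.
  apply: (cvg_unique _ _ cv) => //.
  rewrite (_ : (fun n => _) = cst 0%E); first exact: cvg_cst.
  apply/funext => n /=.
  rewrite -[RHS](_ : (ip L z (flat_bump n.+1%:R a b))%:E = _); last by rewrite zn0.
  by rewrite /ip /Rintegral fineK//; exact: integrable_fin_num (L2_mul_integrable Lz (Lb n)).
by rewrite /ip /Rintegral => <-.
Qed.

(** Since the bump [t] satisfies [0 <= t <= 1], zero mass would force [ip L t t = 0], so [t] would
    vanish almost everywhere, against its positivity on (a, b). *)
Lemma bump_mass_gt0 (a b : R) : 0 <= a -> a < b -> b <= L ->
  0 < ip L (flat_bump 1 a b) (fun=> 1).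
Proof.
move=> a0 ab bL; set t := flat_bump 1 a b.
have Lt : L2fun L t by exact/continuous_L2/flat_alg_continuous/flat_alg_flat_bump.
have t0 : 0 <= ip L t (fun=> 1).
  by apply: Rintegral_ge0 => x _; rewrite mulr1 flat_bump_ge0.
rewrite lt_neqAle t0 andbT; apply/negP => /eqP e.
have /(ip_eq0_ae Lt) H : ip L t t = 0.
  apply/eqP; rewrite eq_le ip_ge0 andbT e; apply: le_Rintegral => //.
  - exact: L2_mul_integrable.
  - exact: L2_mul_integrable.
  - by move=> x _; rewrite ler_wpM2l ?flat_bump_ge0 ?flat_bump_le1.
have [x xab] := ae_itv_ex H ab.
move: (xab) => /andP[ax xb].
have Ix : I x by rewrite /Iopen/= (le_lt_trans a0 ax) (lt_le_trans xb bL).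
by move=> /(_ Ix)/eqP; rewrite gt_eqF// flat_bump_gt0.
Qed.

(** Subtracting the right constant [c] makes [z = w - c] orthogonal to every bump, not only to
    mean-zero functions. Its integral over each interval then vanishes, so its primitive is constant
    and [z] is zero almost everywhere. *)
Lemma du_Bois_Reymond w : 0 < L -> L2fun L w ->
  (forall k (a b : R), flat_alg k -> 0 < a -> a < b -> b < L ->
    (forall x, x <= a \/ b <= x -> k x = 0) -> ip L k (fun=> 1) = 0 ->
    ip L w k = 0) ->
  exists c : R, \forall x \ae mu, I x -> w x = c.
Proof.
move=> L0 Lw H.
(* A reference bump [t] on the middle third serves to correct the mean of the other bumps; [c] below
   is the average of [w] weighted by [t]. *)
pose p := L / 3; pose q := 2 * L / 3.
have p0 : 0 < p by rewrite /p; lra.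
have pq : p < q by rewrite /p /q; lra.
have qL : q < L by rewrite /q; lra.
pose t := flat_bump 1 p q; set m := ip L t (fun=> 1).
have At : flat_alg t by exact: flat_alg_flat_bump.
have Lt : L2fun L t by exact/continuous_L2/flat_alg_continuous.
have m0 : 0 < m by apply: bump_mass_gt0; rewrite ?ltW.
pose c := ip L w t / m; exists c.
pose z := fun x => w x - c.
have Lz : L2fun L z by apply: L2B.
have zab (a b : R) : 0 < a -> a < b -> b < L -> prim L z b = prim L z a.
  move=> a0 ab bL.
  have z0 : ip L z (fun y => (a < y < b)%R%:R) = 0.
    apply: ip_bump_cvg => // n; set e := flat_bump _ a b.
    have Ae : flat_alg e by exact: flat_alg_flat_bump.
    have Le : L2fun L e by exact/continuous_L2/flat_alg_continuous.
    (* k = e + r t has mean zero, so that prim L k is a test function *)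
    pose r := - (ip L e (fun=> 1) / m).
    pose k := fun x => e x + r * t x.
    have Lrt : L2fun L (fun x => r * t x) by exact: L2Z.
    have wk0 : ip L w k = 0.
      (* The support of [k] lies in the convex hull of (a, b) and (p, q). *)
      apply: (H k (Num.min a p) (Num.max b q)).
      - apply: flat_add => //; apply: (@flat_mul _ (fun=> r)) => //; exact: flat_cst.
      - by rewrite lt_min a0.
      - by rewrite lt_max !gt_min ab.
      - by rewrite gt_max bL.
      - move=> x hx; rewrite /k /e /t !flat_bump_out ?mulr0 ?addr0//;
        by move: hx; rewrite le_min ge_max => -[/andP[]|/andP[]]; [left|right].
      - rewrite ipDl// ipZl// -/m /r; field; exact: lt0r_neq0.
    move: wk0; rewrite ipDr// ipZr// ipBl// => wk0.
    rewrite (ip_cstl c)//.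
    rewrite -wk0 /r /c.
    by move: (ip L w e) (ip L w t) (ip L e _) => x1 x2 x3; ring.
  apply/eqP; rewrite -subr_eq0 -[X in _ == X]z0 /prim -ipBr//; apply/eqP.
  rewrite ipC [RHS]ipC; apply: ae_eq_ip => //; first exact: L2B.
    exact: L2_itv.
  apply: filterS (ae_neq a); first exact: (ae_filter_ringOfSetsType mu).
  move=> y; rewrite neq_lt => /orP[ya|ay] _.
    by rewrite (lt_trans ya ab) ya ltNge (ltW ya)/= subrr.
  by rewrite ay ltNge [(y < a)%R]ltNge (ltW ay)/= subr0.
(* Almost everywhere [z] is the derivative of its primitive, which is locally constant on (0, L) by
   [zab]. *)
apply: filterS (prim_derive_ae Lz); first exact: (ae_filter_ringOfSetsType mu).
move=> x [_ dx] Ix; move: dx; rewrite /patch mem_set//.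
move: Ix; rewrite /Iopen/= => /andP[x0 xL].
have -> : derive1 (prim L z) x = 0.
  rewrite derive1E; suff [_ ->] : is_derive x 1 (prim L z) 0 by [].
  apply: (@is_derive_near _ _ (cst (prim L z x))).
  near=> y.
  have y0 : 0 < y by near: y; exact: lt_nbhsr.
  have yL : y < L by near: y; exact: lt_nbhsl.
  have [xy|yx|->//] := ltgtP x y; first by rewrite (zab x y).
  by rewrite (zab y x).
by move=> /esym/eqP; rewrite /z subr_eq0 => /eqP.
Unshelve. all: by end_near.
Qed.

(** For a mean-zero [k], testing the weak derivative with [prim L k] and applying [Fubini_prim]
    shows that [u - prim L g] is orthogonal to [k]; the du Bois-Reymond lemma concludes. *)
Lemma weak_deriv_prim u g : 0 < L -> L2fun L u -> L2fun L g -> weak_deriv L u g ->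
  exists c : R, \forall x \ae mu, I x -> u x = c + prim L g x.
Proof.
move=> L0 Lu Lg ug.
have Lp := L2_prim Lg.
have [|k a b Ak a0 ab bL k0 ik|c Hc] := @du_Bois_Reymond (fun x => u x - prim L g x) L0.
- exact: L2B.
- have [tk dk] := prim_test_fun Ak a0 ab bL k0 ik.
  have Lk : L2fun L k by exact/continuous_L2/flat_alg_continuous.
  have := ug _ tk; rewrite dk -/(ip L u k) -/(ip L g (prim L k)) ipBl// => ->.
  by have := Fubini_prim Lg Lk; rewrite ik mulr0; lra.
exists c; apply: filterS Hc; first exact: (ae_filter_ringOfSetsType mu).
by move=> x h /h <-; rewrite subrK.
Qed.

(** A nonzero value at an endpoint would persist on a one-sided neighbourhood, and any such interval
    contains a zero of [d]. *)
Lemma ae0_continuous_bdry (d : R -> R) : 0 < L -> {within `[0, L], continuous d} ->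
  (\forall x \ae mu, I x -> d x = 0) -> d 0 = 0 /\ d L = 0.
Proof.
move=> L0 cd d0.
have [_ d00 dLL] := (continuous_within_itvP d L0).1 cd.
split; apply: contrapT => /eqP; rewrite -normr_gt0 => da.
- have /cvgrPdist_lt/(_ _ da)[e /= e0 He] := d00.
  have [|x /andP[x0 xe] dx] := ae_itv_ex d0 (_ : 0 < Num.min e L).
    by rewrite lt_min e0.
  move: xe; rewrite lt_min => /andP[xe xL].
  have := He x; rewrite /= sub0r normrN gtr0_norm// => /(_ xe x0).
  by rewrite dx ?subr0 ?ltxx// /Iopen/= x0.
- have /cvgrPdist_lt/(_ _ da)[e /= e0 He] := dLL.
  have [|x /andP[xe xL] dx] := ae_itv_ex d0 (_ : Num.max (L - e) 0 < L).
    by rewrite gt_max L0 andbT; lra.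
  move: xe; rewrite gt_max => /andP[xe x0].
  have := He x; rewrite /= gtr0_norm ?subr_gt0// => /(_ _ xL).
  by rewrite dx ?subr0 ?ltxx /Iopen/= ?x0//; move/(_ _)/negP; apply; lra.
Qed.

(** [trace_at] asserts only that some continuous representative takes the value [s]. Any such
    representative agrees almost everywhere with the continuous [c + prim L g], hence also at the
    endpoints. *)
Lemma trace_prim u g c (a s : R) : 0 < L -> L2fun L g ->
  (\forall x \ae mu, I x -> u x = c + prim L g x) ->
  trace_at L u a s -> a = 0 \/ a = L -> s = c + prim L g a.
Proof.
move=> L0 Lg ue [w [cw [uw <-]]] ha.
have [|||d0 dL] := @ae0_continuous_bdry (fun x => w x - (c + prim L g x)) => //.
- move=> x; apply: cvgB; first exact: cw.
  apply: cvgD; first exact: cvg_cst.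
  by apply: continuous_subspaceT; exact: prim_continuous.
- apply: filterS2 ue uw; first exact: (ae_filter_ringOfSetsType mu).
  by move=> x h1 h2 Ix; rewrite -h2// h1// subrr.
by case: ha => ->; apply/eqP; rewrite -subr_eq0; apply/eqP.
Qed.

(** The trace at 0 identifies the constant of integration as [s]; the equal trace at [L] then forces
    the integral of [h] to vanish. *)
Lemma eq_trace_prim v h (s : R) : 0 < L -> L2fun L v -> L2fun L h ->
  weak_deriv L v h -> trace_at L v 0 s -> trace_at L v L s ->
  (\forall x \ae mu, I x -> v x - s = prim L h x) /\ ip L h (fun=> 1) = 0.
Proof.
move=> L0 Lv Lh vh t0 tL.
have [c Hc] := weak_deriv_prim L0 Lv Lh vh.
have := trace_prim L0 Lh Hc t0 (or_introl erefl).
rewrite prim_le0// addr0 => sc.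
have := trace_prim L0 Lh Hc tL (or_intror erefl).
rewrite prim_ge// sc => hc; split.
  apply: filterS Hc; first exact: (ae_filter_ringOfSetsType mu).
  by move=> x h1 /h1 ->; lra.
lra.
Qed.

(** The boundary term [s (u(L) - u(0))] is expressed through the integral of [g]. As [h] has mean
    zero, the constant of integration of [u] drops out, and [Fubini_prim] transfers the primitive
    from [g] to [h]. *)
Lemma weak_by_parts u g v h (s : R) : 0 < L ->
  L2fun L u -> L2fun L g -> weak_deriv L u g ->
  L2fun L v -> L2fun L h -> weak_deriv L v h ->
  trace_at L v 0 s -> trace_at L v L s ->
  ip L u h = s * ip L g (fun=> 1) - ip L g v.
Proof.
move=> L0 Lu Lg ug Lv Lh vh t0 tL.
have [vs ih] := eq_trace_prim L0 Lv Lh vh t0 tL.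
have [c Hc] := weak_deriv_prim L0 Lu Lg ug.
have Lpg := L2_prim Lg; have Lph := L2_prim Lh.
rewrite (ae_eq_ip _ _ _ Hc)//; last exact: L2D.
rewrite ipDl//.
rewrite (ip_cstl c)//.
rewrite ih mulr0 add0r.
have := Fubini_prim Lg Lh; rewrite ih mulr0.
have : ip L (prim L h) g = ip L (fun x => v x - s) g.
  by apply/esym; apply: ae_eq_ip => //; exact: L2B.
rewrite ipBl// (ipC _ _ g) (ipC _ v).
rewrite (ip_cstl s)//.
lra.
Qed.

(** The zero mean removes the constant from [u = c + prim L g], so [|u|^2 = - <g, prim u>]. Since
    [|prim u| <= L |u|] in norm, Cauchy-Schwarz gives [|u|^4 <= L^2 |g|^2 |u|^2], and [|u|^2] is
    divided out. *)
Lemma Poincare_mean0 u g : 0 < L -> L2fun L u -> L2fun L g -> weak_deriv L u g ->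
  ip L u (fun=> 1) = 0 -> ip L u u <= L ^+ 2 * ip L g g.
Proof.
move=> L0 Lu Lg ug iu.
have [c Hc] := weak_deriv_prim L0 Lu Lg ug.
have Lpg := L2_prim Lg; have Lpu := L2_prim Lu.
have e : ip L u u = - ip L g (prim L u).
  rewrite {1}(ae_eq_ip _ _ _ Hc)//; last exact: L2D.
  rewrite ipDl//.
  rewrite (ip_cstl c)//.
  by have := Fubini_prim Lg Lu; rewrite iu; lra.
have h1 : ip L u u ^+ 2 <= ip L g g * ip L (prim L u) (prim L u).
  by rewrite e sqrrN; exact: L2_CauchySchwarz_sq.
have h2 : ip L (prim L u) (prim L u) <= L ^+ 2 * ip L u u.
  have -> : L ^+ 2 * ip L u u =
      ip L (fun=> norm2 L u * norm2 L (fun=> 1)) (fun=> norm2 L u * norm2 L (fun=> 1)).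
    rewrite ip_cstl// ip_cstl// ip1_cst// mulrCA mulrA mulrACA -!expr2.
    by rewrite !norm2_sq ip1_cst//; ring.
  apply: le_Rintegral => //; try exact: L2_mul_integrable.
  move=> x _; rewrite -!expr2 -[leLHS]real_normK ?num_real// lerXn2r ?nnegrE//.
    by rewrite mulr_ge0 ?norm2_ge0.
  exact: prim_bound.
have u0 := ip_ge0 L u; have g0 := ip_ge0 L g.
have [|up] := leP (ip L u u) 0; first by move=> h; rewrite (le_trans h)// mulr_ge0 ?sqr_ge0.
rewrite -(ler_pM2r up) -expr2; apply: le_trans h1 _.
by rewrite [leRHS]mulrAC [leRHS]mulrC; exact: ler_wpM2l.
Qed.

End WeakDerivative.

(** * Differentiation in time *)

Section Time.
Variable R : realType.

(* Only s >= 0 is allowed, so that the derivative at t = 0 is one-sided. *)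
Definition rderiv (f : R -> R) (t d : R) : Prop :=
  forall eps : R, 0 < eps -> exists2 delta : R, 0 < delta &
    forall s : R, 0 <= s -> s != t -> `|s - t| < delta ->
      `|(f s - f t) / (s - t) - d| < eps.

Definition nderiv (L : R) (a : R -> R -> R) (t : R) (a' : R -> R) : Prop :=
  forall eps : R, 0 < eps -> exists2 delta : R, 0 < delta &
    forall s : R, 0 <= s -> s != t -> `|s - t| < delta ->
      norm2 L (fun x => (a s x - a t x) / (s - t) - a' x) < eps.

Lemma rderiv_is_derive f (t d : R) : 0 < t -> rderiv f t d -> is_derive t 1 f d.
Proof.
move=> t0 H; apply: is_derive_eps => e e0; have [dl dl0 Hd] := H _ e0.
exists (Num.min dl t); first by rewrite lt_min dl0.
move=> h h0; rewrite lt_min => /andP[hd ht].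
have := Hd (t + h); rewrite (addrC t h) addrK; apply=> //.
  by move: ht; rewrite ltr_norml => /andP[? _]; lra.
by rewrite -subr_eq0 addrK.
Qed.

Lemma rderiv_continuous f (t d eps : R) : rderiv f t d -> 0 < eps ->
  exists2 delta : R, 0 < delta &
    forall s : R, 0 <= s -> `|s - t| < delta -> `|f s - f t| < eps.
Proof.
move=> H e0; have [dl dl0 Hd] := H 1 ltr01.
have D0 : 0 < `|d| + 1 by rewrite ltr_wpDl.
exists (Num.min dl (eps / (`|d| + 1))); first by rewrite lt_min dl0 divr_gt0.
move=> s s0; rewrite lt_min => /andP[sd se].
have [->|st] := eqVneq s t; first by rewrite subrr normr0.
have st0 : s - t != 0 by rewrite subr_eq0.
have h := Hd s s0 st sd.
have : `|(f s - f t) / (s - t)| < `|d| + 1.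
  rewrite -(subrK d (_ / _)); apply: le_lt_trans (ler_normD _ _) _.
  by rewrite addrC ltrD2l.
rewrite normrM normfV ltr_pdivrMr ?normr_gt0// => /lt_le_trans; apply.
by rewrite -ler_pdivlMl// mulrC ltW.
Qed.

Lemma rderiv_within f (d : R -> R) (b : R) : 0 < b ->
  (forall t : R, 0 <= t -> rderiv f t (d t)) -> {within `[0, b], continuous f}.
Proof.
move=> b0 H; apply/continuous_within_itvP => //; split.
- move=> x; rewrite in_itv/= => /andP[x0 _].
  have [df _] := rderiv_is_derive x0 (H x (ltW x0)).
  exact/differentiable_continuous/derivable1_diffP.
- apply/cvgrPdist_lt => e e0.
  have [dl dl0 Hd] := rderiv_continuous (H 0 (lexx _)) e0.
  exists dl => //= y; rewrite /= sub0r normrN => yd y0.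
  by rewrite distrC; apply: Hd; [exact: ltW|rewrite subr0].
- apply/cvgrPdist_lt => e e0.
  have [dl dl0 Hd] := rderiv_continuous (H b (ltW b0)) e0.
  exists (Num.min dl b); first by rewrite /= lt_min dl0.
  move=> y /=; rewrite lt_min => /andP[yd yb] _.
  rewrite distrC; apply: Hd; last by rewrite distrC.
  by move: yb; rewrite ltr_norml => /andP[_ ?]; lra.
Qed.

Lemma rderiv_lin f g (t d e a b : R) : rderiv f t d -> rderiv g t e ->
  rderiv (fun s => a * f s + b * g s) t (a * d + b * e).
Proof.
move=> Hf Hg eps e0.
have A0 : 0 < 2 * (`|a| + 1) by rewrite mulr_gt0// ltr_wpDl.
have B0 : 0 < 2 * (`|b| + 1) by rewrite mulr_gt0// ltr_wpDl.
have [df df0 Hdf] := Hf _ (divr_gt0 e0 A0).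
have [dg dg0 Hdg] := Hg _ (divr_gt0 e0 B0).
exists (Num.min df dg); first by rewrite lt_min df0.
move=> s s0 st; rewrite lt_min => /andP[sf sg].
have {}Hdf := Hdf s s0 st sf; have {}Hdg := Hdg s s0 st sg.
set X := _ - d in Hdf; set Y := _ - e in Hdg.
have -> : (a * f s + b * g s - (a * f t + b * g t)) / (s - t) - (a * d + b * e)
  = a * X + b * Y by rewrite /X /Y; ring.
apply: le_lt_trans (ler_normD _ _) _; rewrite !normrM.
move: Hdf Hdg; rewrite !ltr_pdivlMr// => Hdf Hdg.
have := normr_ge0 X; have := normr_ge0 Y; nra.
Qed.

(** If [d] and [e] are the errors of the two difference quotients, the error in the product rule is
    [<d, b t> + <a t, e>] plus [s - t] times a bounded quantity. *)
Lemma ip_rderiv (L : R) (a b : R -> R -> R) (a' b' : R -> R) (t : R) : 0 <= t ->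
  (forall s : R, 0 <= s -> L2fun L (a s)) -> (forall s : R, 0 <= s -> L2fun L (b s)) ->
  L2fun L a' -> L2fun L b' -> nderiv L a t a' -> nderiv L b t b' ->
  rderiv (fun s => ip L (a s) (b s)) t (ip L a' (b t) + ip L (a t) b').
Proof.
move=> t0 La Lb La' Lb' Ha Hb eps e0.
pose A := norm2 L (a t) + norm2 L (b t).
pose B := (norm2 L a' + 1) * (norm2 L b' + 1).
have n0 u : 0 <= norm2 L u by exact: norm2_ge0.
have A0 : 0 <= A by rewrite addr_ge0.
have B0 : 0 <= B by rewrite mulr_ge0// addr_ge0.
(* The bound 1 on the norms of [d] and [e] makes [B] control the factor of [s - t]; the other bound
   keeps the two first-order terms within [eps / 2]. *)
pose eta := Num.min 1 (eps / (2 * (A + 1))).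
have eta0 : 0 < eta by rewrite lt_min ltr01 divr_gt0//; lra.
have [da da0 Hda] := Ha _ eta0; have [db db0 Hdb] := Hb _ eta0.
pose dl := Num.min (eps / (2 * (B + 1))) (Num.min da db).
exists dl; first by rewrite !lt_min da0 db0 divr_gt0//; lra.
move=> s s0 st; rewrite !lt_min => /and3P[sB sa sb].
have st0 : s - t != 0 by rewrite subr_eq0.
pose d := fun x => (a s x - a t x) / (s - t) - a' x.
pose e := fun x => (b s x - b t x) / (s - t) - b' x.
have nd : norm2 L d < eta by exact: Hda.
have ne : norm2 L e < eta by exact: Hdb.
have Lq (u v w : R -> R) : L2fun L u -> L2fun L v -> L2fun L w ->
    L2fun L (fun x => (u x - v x) / (s - t) - w x).
  move=> Lu Lv Lw; have := L2B (L2Z (s - t)^-1 (L2B Lu Lv)) Lw.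
  by under eq_fun do rewrite mulrC.
have Ld : L2fun L d by apply: Lq; auto.
have Le : L2fun L e by apply: Lq; auto.
have Lat := La _ t0; have Lbt := Lb _ t0.
have Lad := L2D La' Ld; have Lbe := L2D Lb' Le.
have Lsad := L2Z (s - t) Lad; have Lsbe := L2Z (s - t) Lbe.
have ea : a s = fun x => a t x + (s - t) * (a' x + d x).
  by apply/funext => x; rewrite /d; field.
have eb : b s = fun x => b t x + (s - t) * (b' x + e x).
  by apply/funext => x; rewrite /e; field.
have Las := La _ s0; have Lbs := Lb _ s0.
have key : (ip L (a s) (b s) - ip L (a t) (b t)) / (s - t) -
    (ip L a' (b t) + ip L (a t) b') =
  ip L d (b t) + ip L (a t) e +
  (s - t) * (ip L a' b' + ip L a' e + ip L d b' + ip L d e).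
  rewrite {1}ea ipDl// ipZl// ipDl//.
  have ex u : L2fun L u ->
      ip L u (b s) = ip L u (b t) + (s - t) * (ip L u b' + ip L u e).
    by move=> Lu; rewrite {1}eb ipDr// ipZr// ipDr.
  rewrite (ex _ Lat) (ex _ La') (ex _ Ld).
  by field.
rewrite key.
have CS u v : L2fun L u -> L2fun L v -> `|ip L u v| <= norm2 L u * norm2 L v.
  by move=> *; exact: L2_CauchySchwarz.
have h1 := CS _ _ Ld Lbt; have h2 := CS _ _ Lat Le.
have h3 := CS _ _ La' Lb'; have h4 := CS _ _ La' Le.
have h5 := CS _ _ Ld Lb'; have h6 := CS _ _ Ld Le.
have [eta1 etaA] : eta <= 1 /\ eta * (2 * (A + 1)) <= eps.
  split; first by rewrite /eta ge_min lexx.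
  by rewrite -ler_pdivlMr ?ge_min ?lexx ?orbT//; lra.
have sB' : `|s - t| * (2 * (B + 1)) < eps by rewrite -ltr_pdivlMr//; lra.
have k1 : `|ip L d (b t) + ip L (a t) e| <= eta * A.
  apply: le_trans (ler_normD _ _) _; rewrite /A.
  have := n0 (a t); have := n0 (b t).
  clear -h1 h2 nd ne; nra.
have k2 : `|ip L a' b' + ip L a' e + ip L d b' + ip L d e| <= B.
  have nd1 : norm2 L d <= 1 by exact: le_trans (ltW nd) eta1.
  have ne1 : norm2 L e <= 1 by exact: le_trans (ltW ne) eta1.
  have q4 : `|ip L a' e| <= norm2 L a'.
    by apply: le_trans h4 _; rewrite ler_piMr.
  have q5 : `|ip L d b'| <= norm2 L b'.
    by apply: le_trans h5 _; rewrite ler_piMl.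
  have q6 : `|ip L d e| <= 1 by apply: le_trans h6 _; rewrite mulr_ile1.
  have t1 := ler_normD (ip L a' b' + ip L a' e + ip L d b') (ip L d e).
  have t2 := ler_normD (ip L a' b' + ip L a' e) (ip L d b').
  have t3 := ler_normD (ip L a' b') (ip L a' e).
  rewrite /B; move: (n0 a') (n0 b') => na nb.
  clear -t1 t2 t3 h3 q4 q5 q6 na nb; nra.
apply: le_lt_trans (ler_normD _ _) _; rewrite normrM.
have : `|s - t| * `|ip L a' b' + ip L a' e + ip L d b' + ip L d e| <= `|s - t| * B.
  by rewrite ler_wpM2l.
have nst : 0 <= `|s - t| by [].
clear -k1 sB' etaA eta0 A0 B0 e0 nst; lra.
Qed.

(** Duhamel's formula weights the forcing at time [s] by [exp(- nu (T - s))]. Growth at half that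
    rate leaves [exp(- nu (T - s) / 2)], whose integral is at most [2 / nu] whatever [T] is. *)
Lemma gronwall_decay (V V' : R -> R) (nu C T : R) : 0 < nu -> 0 <= T -> 0 <= C ->
  (forall t : R, 0 <= t -> rderiv V t (V' t)) ->
  (forall t : R, 0 <= t <= T -> V' t <= - nu * V t + C * expR (nu / 2 * (T - t))) ->
  V T <= expR (- nu * T) * V 0 + 2 * C / nu.
Proof.
move=> nu0 T0 C0 dV HV.
have [T1|T1] := leP T 0.
  have -> : T = 0 by apply/eqP; rewrite eq_le T1.
  by rewrite mulr0 expR0 mul1r lerDl divr_ge0 ?mulr_ge0// ltW.
pose E1 := fun s : R => expR (nu * s).
pose E2 := fun s : R => expR (nu / 2 * T + nu / 2 * s).
have dE (a b x : R) : is_derive x 1 (fun s : R => expR (a + b * s)) (b * expR (a + b * x)).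
  have h : is_derive x 1 (fun s : R => a + b * s) b.
    apply: is_derive_eq; rewrite /GRing.scale/=; ring.
  have := @is_derive1_comp _ expR (fun s => a + b * s) x _ _ (is_derive_expR _) h.
  by move=> h2; apply: (is_derive_eq h2); ring.
have dE1 (x : R) : is_derive x 1 E1 (nu * E1 x).
  have := dE 0 nu x; rewrite add0r.
  by rewrite (_ : (fun s => _) = E1)//; apply/funext => s; rewrite add0r.
have dE2 (x : R) : is_derive x 1 E2 (nu / 2 * E2 x) by exact: dE.
(* C E2 / E1 = C exp(nu (T - s) / 2) is the forcing term: Z is nonincreasing. *)
pose Z := fun s => V s * E1 s - 2 * C / nu * E2 s.
have dZ (x : R) : 0 < x -> is_derive x 1 Z ((V' x + nu * V x) * E1 x - C * E2 x).
  move=> x0; have h1 := rderiv_is_derive x0 (dV x (ltW x0)).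
  have := is_deriveB (is_deriveM h1 (dE1 x)) (is_deriveZ (2 * C / nu) (dE2 x)).
  move=> h2; apply: (is_derive_eq h2); rewrite /GRing.scale/=.
  by field; exact: lt0r_neq0.
have cont g (dg : R -> R) : (forall x : R, is_derive x 1 g (dg x)) ->
    {within `[0, T], continuous g}.
  move=> H; apply: continuous_subspaceT => x.
  by apply/differentiable_continuous/derivable1_diffP; have [] := H x.
have cZ : {within `[0, T], continuous Z}.
  move=> x; apply: cvgB.
    by apply: cvgM; [exact: (rderiv_within T1 dV)|exact: (cont _ _ dE1)].
  by apply: cvgM; [exact: cvg_cst|exact: (cont _ _ dE2)].
have : Z T <= Z 0.
  apply: (@ler0_derive1_le_cc _ Z 0 T) => //; rewrite ?in_itv/= ?lexx ?ltW//.
  - by move=> x; rewrite in_itv/= => /andP[x0 _]; have [] := dZ x x0.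
  - move=> x; rewrite in_itv/= => /andP[x0 xT]; rewrite derive1E.
    have [_ ->] := dZ x x0.
    have h : V' x <= - nu * V x + C * expR (nu / 2 * (T - x)).
      by apply: HV; rewrite !ltW.
    have -> : E2 x = expR (nu / 2 * (T - x)) * E1 x.
      by rewrite /E1 /E2 -expRD; congr expR; field.
    by rewrite mulrA -mulrBl pmulr_lle0 ?expR_gt0//; lra.
have e2 : E2 T = E1 T by rewrite /E1 /E2; congr expR; field.
rewrite /Z e2 /E1 mulr0 expR0 mulr1 -mulrBl => h.
have hc : 0 <= 2 * C / nu * E2 0 by rewrite !mulr_ge0 ?expR_ge0 ?invr_ge0// ltW.
have {}h : (V T - 2 * C / nu) * expR (nu * T) <= V 0 by lra.
by rewrite -lerBlDr mulNr expRN [leRHS]mulrC ler_pdivlMr ?expR_gt0.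
Qed.

End Time.

(** * The energy estimate *)

Lemma ex_small (R : realType) (a b c : R) : 0 < a -> 0 < b -> 0 < c ->
  exists e : R, [/\ 0 < e, e <= a, e <= b & e <= c].
Proof.
move=> a0 b0 c0; exists (Num.min a (Num.min b c)).
by split; rewrite ?lt_min ?a0 ?b0// !ge_min lexx ?orbT.
Qed.

(** Young's inequality, from the square of [c i - L h f], weighted so that only half of the
    dissipation [c b] is spent on the control term. *)
Lemma Young_mean (R : realType) (L h c f i b : R) : 0 < L -> 0 < c ->
  i ^+ 2 <= L * b -> h * f * i <= c * b / 2 + L * h ^+ 2 / (2 * c) * f ^+ 2.
Proof.
move=> L0 c0 ib; have s1 := sqr_ge0 (c * i - L * h * f).
have s2 : 0 < 2 * L * c by rewrite !mulr_gt0.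
rewrite -(ler_pM2l s2) mulrDr.
have -> : 2 * L * c * (L * h ^+ 2 / (2 * c) * f ^+ 2) = (L * h * f) ^+ 2.
  by field; exact: lt0r_neq0.
have : c ^+ 2 * i ^+ 2 <= c ^+ 2 * (L * b) by rewrite ler_wpM2l// sqr_ge0.
nra.
Qed.

(* a, b, d, k, p stand for the squared norms of phi, phi_x, phi_xx, psi, psi_x,
   x for <phi, psi>, and i1, i2 for the integrals of psi_x and phi_x. *)
Lemma energy_constants (R : realType) (L h c2 mu sigma kappa : R) :
  0 < L -> 0 < h -> 0 < c2 -> 0 < mu -> 0 < sigma -> 0 <= kappa ->
  exists (e nu gam m M : R), [/\ 0 < nu, 0 < gam, 0 < m, 0 < M &
  forall a b d k p x i1 i2 f : R,
  [/\ 0 <= a, 0 <= b, 0 <= d, 0 <= k & 0 <= p] ->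
  [/\ a <= L ^+ 2 * b, k <= L ^+ 2 * p, x ^+ 2 <= a * k,
      i1 ^+ 2 <= L * p & i2 ^+ 2 <= L * b] ->
  let V := k / 2 + c2 / 2 * b + sigma * h / 2 * d
           + e * (x + mu / 2 * b + kappa / 2 * a) in
  [/\ m * (a + b + d + k) <= V, V <= M * (a + b + d + k) &
   h * f * i1 - mu * p - kappa * k + e * (k - c2 * b + h * f * i2 - sigma * h * d)
   <= - nu * V + gam * f ^+ 2]].
Proof.
move=> L0 h0 c0 mu0 s0 k0.
(* The first two bounds on [e], with [a <= L^2 b], keep [e x] below half of the leading terms in [k]
   and [b]. The third gives [4 e k <= mu p], so that viscosity absorbs the term [e k]. *)
have [e [e0 e1 e2 e3]] : exists e : R,
    [/\ 0 < e, 2 * e <= 1, 2 * (e * L ^+ 2) <= c2 & 4 * (e * L ^+ 2) <= mu].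
  have L2 : 0 < L ^+ 2 by rewrite exprn_gt0.
  have [e [e0 e1 e2 e3]] := ex_small (divr_gt0 ltr01 (ltr0Sn R 1))
    (divr_gt0 c0 (mulr_gt0 (ltr0Sn R 1) L2)) (divr_gt0 mu0 (mulr_gt0 (ltr0Sn R 3) L2)).
  rewrite ler_pdivlMr ?mulr_gt0// in e2; rewrite ler_pdivlMr ?mulr_gt0// in e3.
  by exists e; split=> //; [clear -e1|clear -e2|clear -e3]; lra.
(* [Q] bounds the coefficient of [b] in [2 V] once [a] is replaced by [L^2 b]. Then [nu <= e] and
   [nu Q <= e c2] let the dissipation dominate [nu V]. *)
pose Q := c2 + L ^+ 2 + mu + kappa * L ^+ 2.
have Q0 : 0 < Q.
  by have := mulr_ge0 k0 (sqr_ge0 L); have := exprn_gt0 2 L0; rewrite /Q; lra.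
have [nu [nu0 nue nuQ _]] := ex_small e0 (divr_gt0 (mulr_gt0 e0 c0) Q0) ltr01.
rewrite ler_pdivlMr// in nuQ.
have sh0 : 0 < sigma * h by rewrite mulr_gt0.
have L21 : 0 < 1 + L ^+ 2 by rewrite ltr_wpDr// sqr_ge0.
(* The cross term leaves at least a quarter of [k] and of [c2 b]; the factor [1 + L^2] appears
   because [b] must control [a] as well. *)
have [m [m0 m1 m2 m3]] : exists m : R,
    [/\ 0 < m, 4 * m <= 1, 4 * (m * (1 + L ^+ 2)) <= c2 & 2 * m <= sigma * h].
  have [m [m0 m1 m2 m3]] := ex_small (divr_gt0 ltr01 (ltr0Sn R 3))
    (divr_gt0 c0 (mulr_gt0 (ltr0Sn R 3) L21)) (divr_gt0 sh0 (ltr0Sn R 1)).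
  rewrite ler_pdivlMr ?mulr_gt0// in m2.
  by exists m; split=> //; [clear -m1|clear -m2|clear -m3]; lra.
(* The sum of the two constants from [Young_mean]: weight [mu] for [i1], weight [c2] for [i2]. *)
pose gam := L * h ^+ 2 / (2 * mu) + e * (L * h ^+ 2 / (2 * c2)).
exists e, nu, gam, m, (1 + c2 + sigma * h + mu + kappa).
split => //; [|by clear -c0 sh0 mu0 k0; lra|].
  by rewrite addr_gt0// ?mulr_gt0 ?invr_gt0 ?mulr_gt0 ?exprn_gt0.
move=> a b d k p x i1 i2 f [a0 b0 d0 kk0 p0] [ab kp xx I1 I2] V.
have [x1 x2] : 2 * x <= a + k /\ - (a + k) <= 2 * x.
  have : (2 * x) ^+ 2 <= (a + k) ^+ 2.
    by have := sqr_ge0 (a - k); clear -xx; nra.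
  rewrite -ler_sqrt ?sqr_ge0// !sqrtr_sqr (ger0_norm (addr_ge0 a0 kk0)).
  by rewrite ler_norml => /andP[].
have eab : e * a <= e * L ^+ 2 * b by rewrite -mulrA ler_wpM2l// ltW.
have [ekk ea2] : e * k <= k / 2 /\ e * a <= a / 2.
  by split; clear -e1 a0 kk0; nra.
have ec : 2 * (e * L ^+ 2 * b) <= c2 * b by clear -e2 b0; nra.
have [mb0 ka0] : 0 <= mu * b /\ 0 <= kappa * a by rewrite !mulr_ge0// ltW.
have [emb eka] : 0 <= e * (mu * b) /\ 0 <= e * (kappa * a).
  by rewrite !mulr_ge0// ltW.
have [emb2 eka2] : e * (mu * b) <= mu * b / 2 /\ e * (kappa * a) <= kappa * a / 2.
  by split; clear -e1 mb0 ka0; nra.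
have [ex1 ex2] : 2 * (e * x) <= e * a + e * k /\ - (e * a + e * k) <= 2 * (e * x).
  by split; clear -e0 x1 x2; nra.
have VE : V = k / 2 + c2 * b / 2 + sigma * h * d / 2 + e * x
              + e * (mu * b) / 2 + e * (kappa * a) / 2.
  by rewrite /V; field.
clearbody V; split.
- have ma : m * a <= m * L ^+ 2 * b by rewrite -mulrA ler_wpM2l// ltW.
  have mb : 4 * (m * b + m * L ^+ 2 * b) <= c2 * b by clear -m2 b0; nra.
  have md : 2 * (m * d) <= sigma * h * d by clear -m3 d0; nra.
  have mk : 4 * (m * k) <= k by clear -m1 kk0; nra.
  rewrite VE; clear -ma mb md mk ekk ec eab ex2 emb eka; lra.
- have [pc ps pm] : [/\ 0 <= c2, 0 <= sigma * h & 0 <= mu] by split; exact: ltW.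
  have cs1 := mulr_ge0 pc b0; have cs2 := mulr_ge0 ps d0.
  have s2 : 0 <= (c2 + sigma * h + mu + kappa) * (a + b + d + k) -
      (c2 * b + sigma * h * d + mu * b + kappa * a).
    have -> : (c2 + sigma * h + mu + kappa) * (a + b + d + k) -
        (c2 * b + sigma * h * d + mu * b + kappa * a) =
        c2 * (a + d + k) + sigma * h * (a + b + k) + mu * (a + d + k)
        + kappa * (b + d + k) by ring.
    by rewrite !addr_ge0// mulr_ge0// !addr_ge0.
  have -> : (1 + c2 + sigma * h + mu + kappa) * (a + b + d + k) =
      (a + b + d + k) + (c2 + sigma * h + mu + kappa) * (a + b + d + k) by ring.
  rewrite VE; clear -s2 cs1 cs2 ex1 ekk ea2 emb2 eka2 mb0 ka0 a0 b0 d0 kk0; lra.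
- have g1 := Young_mean h f L0 mu0 I1.
  have g2 := Young_mean h f L0 c0 I2.
  have g3 := ler_wpM2l (ltW e0) g2.
  have g4 : 4 * (e * k) <= mu * p.
    have : e * k <= e * (L ^+ 2 * p) by rewrite ler_wpM2l// ltW.
    by clear -e3 p0; nra.
  have g5 : 0 <= kappa * k by rewrite mulr_ge0.
  have kab : kappa * a <= kappa * L ^+ 2 * b by rewrite -mulrA ler_wpM2l.
  have Lb : 0 <= L ^+ 2 * b by rewrite mulr_ge0// sqr_ge0.
  have V2 : 2 * V <= 2 * k + Q * b + sigma * h * d.
    rewrite VE /Q !mulrDl; clear -kab Lb ex1 ekk eab ec emb2 eka2 mb0 ka0 ea2 kk0 ab; lra.
  have v1 := ler_wpM2l (ltW nu0) V2.
  have v2 : nu * k <= e * k by rewrite ler_wpM2r.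
  have v3 : nu * Q * b <= e * c2 * b by rewrite ler_wpM2r.
  have shd : 0 <= sigma * h * d by rewrite mulr_ge0// ltW.
  have v4 : nu * (sigma * h * d) <= e * (sigma * h * d) by rewrite ler_wpM2r.
  have v5 : 0 <= e * (sigma * h * d) by rewrite mulr_ge0// ltW.
  rewrite /gam mulrDl; clear -g1 g3 g4 g5 v1 v2 v3 v4 v5; clearbody Q; lra.
Qed.

Lemma nderiv_Hk (R : realType) (L : R) (n j : nat) (U V : R -> nat -> R -> R) (t : R) :
  (j <= n)%N -> 0 <= t -> deriv_Hk L n U V -> nderiv L (fun s => U s j) t (V t j).
Proof.
move=> jn t0 H e e0; have [dl dl0 Hd] := H t t0 e e0.
exists dl => // s s0 st sd; apply: le_lt_trans (Hd s s0 st sd).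
rewrite /Hk_dist (bigD1 (Ordinal (jn : (j < n.+1)%N)))//= lerDl.
by apply: sumr_ge0 => i _; exact: norm2_ge0.
Qed.

(** [sup] bounds a set only if the set is bounded above, which the extreme value theorem provides
    here. *)
Lemma sup_weighted (R : realType) (f : R -> R) (lam T : R) : 0 <= T ->
  {within `[0, +oo[, continuous f} ->
  let K := sup [set y | exists2 s, 0 <= s <= T & y = expR (- lam * (T - s)) * `|f s|] in
  forall s, 0 <= s <= T -> expR (- lam * (T - s)) * `|f s| <= K.
Proof.
move=> T0 cf K s sT; apply: ub_le_sup; last by exists s.
pose g := fun s => expR (- lam * (T - s)) * `|f s|.
have cg : {within `[0, T], continuous g}.
  have cfT : {within `[0, T], continuous f}.
    apply: continuous_subspaceW cf => x /=; rewrite !in_itv/= => /andP[-> _]//.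
  move=> x; apply: cvgM.
    apply: continuous_subspaceT => y; apply: continuous_comp; last exact: continuous_expR.
    apply: cvgM; first exact: cvg_cst.
    by apply: cvgB; [exact: cvg_cst|exact: cvg_id].
  exact: cvg_norm (cfT x).
have [c _ Hc] := EVT_max T0 cg.
by exists (g c) => y [r rT ->]; apply: Hc; rewrite in_itv.
Qed.

(** The product rule differentiates each term, the equation replaces [phi_tt], and integrations by
    parts cancel the indefinite terms. The two corrections multiplied by [e] besides [<phi, psi>]
    cancel what viscosity and friction contribute to [<phi, phi_tt>]. *)
Lemma energy_rderiv (R : realType) (L hs c2 mu sigma kappa e : R) (f : R -> R)
    (Phi Phit : R -> nat -> R -> R) (Phitt : R -> R -> R) : 0 < L -> 0 < sigma ->
  (forall t, 0 <= t -> Hk_fam L 4 (Phi t)) ->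
  (forall t, 0 <= t -> in_Sbar L (Phit t)) ->
  deriv_Hk L 2 Phi Phit ->
  (forall t, 0 <= t -> L2fun L (Phitt t)) ->
  deriv_Hk L 0 (fun t _ => Phit t 0%N) (fun t _ => Phitt t) ->
  (forall t, 0 <= t ->
     \forall x \ae (@lebesgue_measure R), Iopen L x ->
       Phitt t x = c2 * Phi t 2%N x - sigma * hs * Phi t 4%N x
                   + mu * Phit t 2%N x - kappa * Phit t 0%N x) ->
  (forall t, 0 <= t ->
     trace_at L (Phi t 1%N) 0 0 /\ trace_at L (Phi t 1%N) L 0 /\
     trace_at L (Phi t 3%N) 0 (- sigma^-1 * f t) /\
     trace_at L (Phi t 3%N) L (- sigma^-1 * f t)) ->
  forall t, 0 <= t ->
  rderiv (fun s => ip L (Phit s 0%N) (Phit s 0%N) / 2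
                   + c2 / 2 * ip L (Phi s 1%N) (Phi s 1%N)
                   + sigma * hs / 2 * ip L (Phi s 2%N) (Phi s 2%N)
                   + e * (ip L (Phi s 0%N) (Phit s 0%N)
                          + mu / 2 * ip L (Phi s 1%N) (Phi s 1%N)
                          + kappa / 2 * ip L (Phi s 0%N) (Phi s 0%N))) t
    (hs * f t * ip L (Phit t 1%N) (fun=> 1)
     - mu * ip L (Phit t 1%N) (Phit t 1%N) - kappa * ip L (Phit t 0%N) (Phit t 0%N)
     + e * (ip L (Phit t 0%N) (Phit t 0%N) - c2 * ip L (Phi t 1%N) (Phi t 1%N)
            + hs * f t * ip L (Phi t 1%N) (fun=> 1)
            - sigma * hs * ip L (Phi t 2%N) (Phi t 2%N))).
Proof.
move=> L0 s0 HPhi HPhit dPhi LPhitt dPhit pde bc t t0.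
have LP j s : (j <= 4)%N -> 0 <= s -> L2fun L (Phi s j).
  by move=> j4 s0'; have [H _] := HPhi s s0'; exact: H.
have LPt j s : (j <= 2)%N -> 0 <= s -> L2fun L (Phit s j).
  by move=> j4 s0'; have [[H _] _] := HPhit s s0'; exact: H.
have dP j : (j <= 2)%N -> nderiv L (fun s => Phi s j) t (Phit t j).
  by move=> j2; exact: nderiv_Hk dPhi.
have dPt : nderiv L (fun s => Phit s 0%N) t (Phitt t).
  exact: (@nderiv_Hk _ L 0 0 _ _ t _ t0 dPhit).
have dip (a b : R -> R -> R) a' b' :
    (forall s, 0 <= s -> L2fun L (a s)) -> (forall s, 0 <= s -> L2fun L (b s)) ->
    L2fun L a' -> L2fun L b' -> nderiv L a t a' -> nderiv L b t b' ->
    rderiv (fun s => ip L (a s) (b s)) t (ip L a' (b t) + ip L (a t) b').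
  by move=> *; exact: ip_rderiv.
have LPs j : (j <= 4)%N -> forall s, 0 <= s -> L2fun L (Phi s j).
  by move=> j4 s s0'; exact: LP.
have LPts j : (j <= 2)%N -> forall s, 0 <= s -> L2fun L (Phit s j).
  by move=> j4 s s0'; exact: LPt.
have Ltt := LPhitt t t0.
have D1 := dip _ _ _ _ (LPts 0%N isT) (LPts 0%N isT) Ltt Ltt dPt dPt.
have D2 := dip _ _ _ _ (LPs 1%N isT) (LPs 1%N isT) (LPt 1%N t isT t0)
  (LPt 1%N t isT t0) (dP 1%N isT) (dP 1%N isT).
have D3 := dip _ _ _ _ (LPs 2%N isT) (LPs 2%N isT)
  (LPt 2%N t isT t0) (LPt 2%N t isT t0) (dP 2%N isT) (dP 2%N isT).
have D4 := dip _ _ _ _ (LPs 0%N isT) (LPts 0%N isT) (LPt 0%N t isT t0) Ltt (dP 0%N isT) dPt.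
have D5 := dip _ _ _ _ (LPs 0%N isT) (LPs 0%N isT) (LPt 0%N t isT t0)
  (LPt 0%N t isT t0) (dP 0%N isT) (dP 0%N isT).
clear dip.
(* The coefficient [(c2 + e * mu) / 2] merges the two occurrences of [|phi_x|^2] in the energy. *)
have D := rderiv_lin 1 1 (rderiv_lin (1 / 2) ((c2 + e * mu) / 2) D1 D2)
  (rderiv_lin (sigma * hs / 2) 1 D3 (rderiv_lin e (e * kappa / 2) D4 D5)).
have [_ wP] := HPhi t t0; have [[_ wPt] [tPt0 tPtL]] := HPhit t t0.
have [tP0 [tPL [tP30 tP3L]]] := bc t t0.
have I0 : L2fun L (Phi t 0%N) by exact: LP.
have I1 : L2fun L (Phi t 1%N) by exact: LP.
have I2 : L2fun L (Phi t 2%N) by exact: LP.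
have I3 : L2fun L (Phi t 3%N) by exact: LP.
have I4 : L2fun L (Phi t 4%N) by exact: LP.
have J0 : L2fun L (Phit t 0%N) by exact: LPt.
have J1 : L2fun L (Phit t 1%N) by exact: LPt.
have J2 : L2fun L (Phit t 2%N) by exact: LPt.
have w0 := wP 0%N isT; have w1 := wP 1%N isT.
have w2 := wP 2%N isT; have w3 := wP 3%N isT.
have v0 := wPt 0%N isT; have v1 := wPt 1%N isT.
(* Pairings with [psi]. In [A2] the common trace [- f / sigma] of [phi_xxx] brings in the control;
   [A3] turns the remaining [<psi_x, phi_xxx>] into [- <phi_xx, psi_xx>]. *)
have A1 := weak_by_parts L0 J0 J1 v0 I1 I2 w1 tP0 tPL.
have A2 := weak_by_parts L0 J0 J1 v0 I3 I4 w3 tP30 tP3L.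
have A3 := weak_by_parts L0 I2 I3 w2 J1 J2 v1 tPt0 tPtL.
have A4 := weak_by_parts L0 J0 J1 v0 J1 J2 v1 tPt0 tPtL.
(* The same pairings with [phi] in place of [psi], except that [B4] keeps [psi_xx]. *)
have B1 := weak_by_parts L0 I0 I1 w0 I1 I2 w1 tP0 tPL.
have B2 := weak_by_parts L0 I0 I1 w0 I3 I4 w3 tP30 tP3L.
have B3 := weak_by_parts L0 I2 I3 w2 I1 I2 w1 tP0 tPL.
have B4 := weak_by_parts L0 I0 I1 w0 J1 J2 v1 tPt0 tPtL.
have ptt u : L2fun L u -> ip L u (Phitt t) =
    c2 * ip L u (Phi t 2%N) - sigma * hs * ip L u (Phi t 4%N)
    + mu * ip L u (Phit t 2%N) - kappa * ip L u (Phit t 0%N).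
  move=> Lu; rewrite ipC.
  have K1 := L2Z c2 I2; have K2 := L2Z (sigma * hs) I4.
  have K3 := L2Z mu J2; have K4 := L2Z kappa J0.
  have K12 := L2B K1 K2; have K123 := L2D K12 K3; have K1234 := L2B K123 K4.
  rewrite (ae_eq_ip Ltt K1234 Lu (pde t t0)) ipC.
  by rewrite ipBr// ipDr// ipBr// !ipZr.
move: D; rewrite (ipC L (Phitt t)) !ptt// A1 A2 A4 B1 B2 B4.
rewrite (ipC L (Phit t 1%N) (Phi t 1%N)) (ipC L (Phit t 2%N) (Phi t 2%N)).
rewrite (ipC L (Phit t 0%N) (Phi t 0%N)) A3 B3.
rewrite (ipC L (Phi t 3%N) (Phit t 1%N)) (ipC L (Phi t 3%N) (Phi t 1%N)).
set F := (X in rderiv X _ _); set G := (X in _ -> rderiv X _ _).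
have -> : F = G by apply/funext => s; rewrite /F /G; field.
set d1 := (X in rderiv _ _ X); set d2 := (X in _ -> rderiv _ _ X).
suff -> : d1 = d2 by [].
rewrite /d1 /d2; field; exact: lt0r_neq0.
Qed.

Theorem theorem5 (R : realType) (L hs g mu sigma kappa : R)
  (hL : 0 < L) (hhs : 0 < hs) (hg : 0 < g) (hmu : 0 < mu) (hsigma : 0 < sigma)
  (hkappa : 0 <= kappa) :
  let c := Num.sqrt (g * hs) in
  exists (M lam Gam : R), 0 < M /\ 0 < lam /\ 0 < Gam /\
  forall (f : R -> R)
         (Phi : R -> nat -> R -> R)   (* Phi t j = j-th x-derivative of phi[t] *)
         (Phit : R -> nat -> R -> R)  (* Phit t j = j-th x-derivative of phi_t[t] *)
         (Phitt : R -> R -> R),       (* Phitt t = phi_tt[t] *)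
    {within `[0, +oo[, continuous f} ->
    (* phi in C^0(R_+; S-bar /\ H^4) *)
    (forall t, 0 <= t -> Hk_fam L 4 (Phi t) /\ in_Sbar L (Phi t)) ->
    cont_Hk L 4 Phi ->
    (* phi in C^1(R_+; S-bar) *)
    (forall t, 0 <= t -> in_Sbar L (Phit t)) ->
    deriv_Hk L 2 Phi Phit ->
    cont_Hk L 2 Phit ->
    (* phi in C^2(R_+; L^2) *)
    (forall t, 0 <= t -> L2fun L (Phitt t)) ->
    deriv_Hk L 0 (fun t _ => Phit t 0%N) (fun t _ => Phitt t) ->
    cont_Hk L 0 (fun t _ => Phitt t) ->
    (* the PDE, a.e. on (0,L) *)
    (forall t, 0 <= t ->
       \forall x \ae (@lebesgue_measure R), Iopen L x ->
         Phitt t x = c ^+ 2 * Phi t 2%N x - sigma * hs * Phi t 4%N x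
                     + mu * Phit t 2%N x - kappa * Phit t 0%N x) ->
    (* boundary conditions *)
    (forall t, 0 <= t ->
       trace_at L (Phi t 1%N) 0 0 /\ trace_at L (Phi t 1%N) L 0 /\
       trace_at L (Phi t 3%N) 0 (- sigma^-1 * f t) /\
       trace_at L (Phi t 3%N) L (- sigma^-1 * f t)) ->
    (* zero mean *)
    (forall t, 0 <= t ->
       Rintegral (@lebesgue_measure R) (Iopen L) (Phi t 0%N) = 0 /\
       Rintegral (@lebesgue_measure R) (Iopen L) (Phit t 0%N) = 0) ->
    let P := fun t => Num.sqrt (norm2 L (Phi t 0%N) ^+ 2 + norm2 L (Phi t 1%N) ^+ 2
                          + norm2 L (Phi t 2%N) ^+ 2 + norm2 L (Phit t 0%N) ^+ 2) in
    forall t, 0 <= t ->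
      P t <= M * expR (- lam * t) * P 0
             + Gam * sup [set y | exists2 s, 0 <= s <= t &
                                   y = expR (- lam * (t - s)) * `|f s| ].
Proof.
move=> c.
have c20 : 0 < c ^+ 2 by rewrite exprn_gt0// sqrtr_gt0 mulr_gt0.
have [e [nu [gam [m [M [nu0 gam0 m0 M0 HE]]]]]] :=
  energy_constants hL hhs c20 hmu hsigma hkappa.
(* The bounds [m P^2 <= V <= M P^2] and [gronwall_decay] yield an estimate of [P^2] with constants
   [M / m] and [2 gam / (nu m)], hence the square roots. *)
exists (Num.sqrt (M / m)), (nu / 4), (Num.sqrt (2 * gam / nu / m)).
split; first by rewrite sqrtr_gt0 divr_gt0.
split; first by rewrite divr_gt0.
split; first by rewrite sqrtr_gt0 !divr_gt0// mulr_gt0.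
move=> f Phi Phit Phitt cf HPhi _ HPhit dPhi _ LPhitt dPhit _ pde bc mean P T T0.
have HPhi4 t : 0 <= t -> Hk_fam L 4 (Phi t) by move=> /HPhi[].
have dV := @energy_rderiv R L hs (c ^+ 2) mu sigma kappa e f Phi Phit Phitt
  hL hsigma HPhi4 HPhit dPhi LPhitt dPhit pde bc.
set V := (fun s : R => _) in dV.
have HEt t : 0 <= t ->
    [/\ m * P t ^+ 2 <= V t, V t <= M * P t ^+ 2 & 
    hs * f t * ip L (Phit t 1%N) (fun=> 1)
     - mu * ip L (Phit t 1%N) (Phit t 1%N) - kappa * ip L (Phit t 0%N) (Phit t 0%N)
     + e * (ip L (Phit t 0%N) (Phit t 0%N) - c ^+ 2 * ip L (Phi t 1%N) (Phi t 1%N)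
            + hs * f t * ip L (Phi t 1%N) (fun=> 1)
            - sigma * hs * ip L (Phi t 2%N) (Phi t 2%N)) <= - nu * V t + gam * f t ^+ 2].
  move=> t0; have [LP wP] := HPhi4 t t0; have [[LPt wPt] _] := HPhit t t0.
  have [mP mPt] := mean t t0.
  have I0 := LP 0%N isT; have I1 := LP 1%N isT; have I2 := LP 2%N isT.
  have J0 := LPt 0%N isT; have J1 := LPt 1%N isT.
  have -> : P t ^+ 2 = ip L (Phi t 0%N) (Phi t 0%N) + ip L (Phi t 1%N) (Phi t 1%N)
      + ip L (Phi t 2%N) (Phi t 2%N) + ip L (Phit t 0%N) (Phit t 0%N).
    by rewrite /P !norm2_sq sqr_sqrtr// !addr_ge0 ?ip_ge0.
  have CS1 u : L2fun L u -> ip L u (fun=> 1) ^+ 2 <= L * ip L u u.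
    move=> Lu; have := L2_CauchySchwarz_sq Lu (L2_cst L 1).
    by rewrite ip1_cst// mulrC.
  apply: HE; first by split; exact: ip_ge0.
  split.
  - apply: Poincare_mean0 => //; first exact: wP.
    by rewrite ip1r.
  - apply: Poincare_mean0 => //; first exact: wPt.
    by rewrite ip1r.
  - exact: L2_CauchySchwarz_sq.
  - exact: CS1.
  - exact: CS1.
set lam := nu / 4.
set K := sup _.
have HK := @sup_weighted _ f lam T T0 cf; rewrite -/K /= in HK.
have K0 : 0 <= K.
  by apply: le_trans (HK T _); rewrite ?lexx ?T0// mulr_ge0 ?expR_ge0.
have fK s : 0 <= s <= T -> f s ^+ 2 <= K ^+ 2 * expR (nu / 2 * (T - s)).
  move=> sT; have := HK s sT; rewrite mulNr expRN mulrC ler_pdivrMr ?expR_gt0// => h.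
  have -> : nu / 2 * (T - s) = 2%:R * (lam * (T - s)) by rewrite /lam; field.
  rewrite expRM_natl -exprMn -real_normK ?num_real//.
  by rewrite lerXn2r ?nnegrE// mulr_ge0 ?expR_ge0.
have := @gronwall_decay _ V _ nu (gam * K ^+ 2) T nu0 T0 _ dV.
have C0 : 0 <= gam * K ^+ 2 by rewrite mulr_ge0 ?sqr_ge0// ltW.
move=> /(_ C0) G.
have {}G : V T <= expR (- nu * T) * V 0 + 2 * (gam * K ^+ 2) / nu.
  apply: G => t /andP[t0 tT]; have [_ _] := HEt t t0.
  move=> /le_trans; apply; rewrite lerD2l -mulrA ler_wpM2l ?(ltW gam0)//.
  by apply: fK; rewrite t0.
have [lowT _ _] := HEt T T0; have [_ up0 _] := HEt 0 (lexx _).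
have P0 t : 0 <= P t by exact: sqrtr_ge0.
set A := Num.sqrt (M / m); set B := Num.sqrt (2 * gam / nu / m).
have A2 : A ^+ 2 = M / m by rewrite sqr_sqrtr// divr_ge0// ltW.
have B2 : B ^+ 2 = 2 * gam / nu / m by rewrite sqr_sqrtr// !divr_ge0 ?mulr_ge0// ltW.
have A0 : 0 <= A by exact: sqrtr_ge0.
have B0 : 0 <= B by exact: sqrtr_ge0.
have X0 : 0 <= A * expR (- lam * T) * P 0 by rewrite !mulr_ge0 ?expR_ge0.
have Y0 : 0 <= B * K by rewrite mulr_ge0.
(* Squares are compared: the square of the right-hand side exceeds the sum of the two squares by a
   nonnegative cross term. *)
rewrite -ler_sqr ?nnegrE ?addr_ge0//.
have hX : M / m * expR (- nu * T) * P 0 ^+ 2 <= (A * expR (- lam * T) * P 0) ^+ 2.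
  rewrite !exprMn A2 ler_wpM2r ?sqr_ge0// ler_wpM2l ?divr_ge0 ?(ltW M0) ?(ltW m0)//.
  rewrite -expRM_natl ler_expR /lam.
  have : 0 <= nu * T by rewrite mulr_ge0// ltW.
  lra.
have hm : P T ^+ 2 <= M / m * expR (- nu * T) * P 0 ^+ 2 + (B * K) ^+ 2.
  rewrite -(ler_pM2l m0); apply: le_trans lowT (le_trans G _).
  rewrite exprMn B2.
  have : expR (- nu * T) * V 0 <= expR (- nu * T) * (M * P 0 ^+ 2).
    by rewrite ler_wpM2l ?expR_ge0.
  move=> h; apply: le_trans (lerD h (lexx _)) _.
  rewrite le_eqVlt; apply/orP; left; apply/eqP; field.
  by rewrite !lt0r_neq0.
have XY := mulr_ge0 X0 Y0; rewrite sqrrD; clear -hX hm XY; lra.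
Qed.
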